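(* Let $r\ge2$ be an integer, $w(x)=x^\alpha(1-x)^\beta$ with $\alpha,\beta>0$, $\varphi(x)=\sqrt{x(1-x)}$, $0\le\lambda\le1$, and let $B^\ast_{n,r-1}$ be the modified combination of Bernstein operators described in the context. Then there is a constant $C>0$ independent of $n$, $x$ and $f$ such that for $x\in(0,1)$: (i) for every $f\in C_w$, $$|w(x)\varphi^{r\lambda}(x)(B^{\ast}_{n,r-1}(f))^{(r)}(x)|\leqslant C\,n^{r/2}\max\{n^{r(1-\lambda)/2},\varphi^{r(\lambda-1)}(x)\}\,\|wf\|;$$ (ii) for every $f\in W^r_{w,\lambda}$, $$|w(x)\varphi^{r\lambda}(x)(B^{\ast}_{n,r-1}(f))^{(r)}(x)|\leqslant C\,\|w\varphi^{r\lambda}f^{(r)}\|.$$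
   Context: $C_w=\{f\in C((0,1)):\lim_{x\to0}(wf)(x)=\lim_{x\to1}(wf)(x)=0\}$, $\|g\|=\sup_{0\le x\le1}|g(x)|$. $W^r_{w,\lambda}=\{f\in C_w: f^{(r-1)}\text{ absolutely continuous on }(0,1),\ \|w\varphi^{r\lambda}f^{(r)}\|<\infty\}$. Bernstein operators: $B_m(g,x)=\sum_{k=0}^m g(k/m)\binom{m}{k}x^k(1-x)^{m-k}$. Combination: $B_{n,r-1}(g,x)=\sum_{i=0}^{r-2}C_i(n)B_{n_i}(g,x)$, where (a) $n=n_0<n_1<\dots<n_{r-2}\le Cn$, (b) $\sum_i|C_i(n)|\le C$, (c) $\sum_i C_i(n)=1$, (d) $\sum_i C_i(n)n_i^{-k}=0$ for $k=1,\dots,r-2$. Modified operator: $B^\ast_{n,r-1}(f,x)=B_{n,r-1}(F_n,x)$, where: $L_r(f,x)$ is the Lagrange interpolation polynomial of $f$ at nodes $i/n$, $i=1,\dots,r$; $R_r(f,x)$ the one at nodes $1-i/n$, $i=1,\dots,r$; $\psi\in C^\infty(\mathbb R)$, $0\le\psi\le1$, $\psi(t)=0$ for $t\le0$, $\psi(t)=1$ for $t\ge1$; $F_n=f$ on $[2/n,1-2/n]$, $F_n=L_r(f,\cdot)$ on $[0,1/n]$, $F_n(x)=L_r(f,x)+\psi(nx-1)(f(x)-L_r(f,x))$ on $[1/n,2/n]$, $F_n=R_r(f,\cdot)$ on $[1-1/n,1]$, $F_n(x)=R_r(f,x)+\psi(n-nx-1)(f(x)-R_r(f,x))$ on $[1-2/n,1-1/n]$.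 *)

(* Defs.v *)
From HB Require Import structures.
From mathcomp Require Import all_boot all_order all_algebra.
From mathcomp Require Import all_classical all_reals all_analysis.
From mathcomp Require Import ess_sup_inf.
Set Implicit Arguments. Unset Strict Implicit. Unset Printing Implicit Defensive.
Import Order.TTheory GRing.Theory Num.Theory.
Import numFieldNormedType.Exports.
Local Open Scope classical_set_scope.
Local Open Scope ring_scope.

Section Defs.
Variable R : realType.

Definition wgt (al be : R) (x : R) : R := x `^ al * (1 - x) `^ be.

Definition phi (x : R) : R := Num.sqrt (x * (1 - x)).

Definition in_Cw (al be : R) (f : R -> R) : Prop :=
  (forall x : R, 0 < x < 1 -> {for x, continuous f}) /\
  ((fun x => wgt al be x * f x) @ 0^'+ --> (0 : R)) /\
  ((fun x => wgt al be x * f x) @ 1^'- --> (0 : R)).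

(* ||w f|| = sup_{0<x<1} |w(x) f(x)| (wf extended by its limits 0 at 0,1) *)
Definition wnorm (al be : R) (f : R -> R) : R :=
  sup [set `|wgt al be x * f x| | x in [set x : R | 0 < x < 1]].

Definition abs_cont_on (a b : R) (g : R -> R) : Prop :=
  forall e : R, 0 < e -> exists2 d : R, 0 < d &
    forall (N : nat) (u v : nat -> R),
      (forall k, (k < N)%N -> a <= u k /\ u k < v k /\ v k <= b) ->
      (forall k, (k.+1 < N)%N -> v k <= u k.+1) ->
      \sum_(k < N) (v k - u k) < d ->
      \sum_(k < N) `|g (v k) - g (u k)| < e.

Definition abs_cont_oo01 (g : R -> R) : Prop :=
  forall a b : R, 0 < a -> a <= b -> b < 1 -> abs_cont_on a b g.

Definition wnorm_r (al be lam : R) (r : nat) (f : R -> R) : \bar R :=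
  ess_sup (@lebesgue_measure R)
    (fun x : R => if (0 < x < 1) then
        (`|wgt al be x * phi x `^ (r%:R * lam) * derive1n r f x|)%:E
     else 0%E).

Definition in_W (al be lam : R) (r : nat) (f : R -> R) : Prop :=
  in_Cw al be f /\
  (forall k : nat, (k < r.-1)%N -> forall x : R, 0 < x < 1 ->
      derivable (derive1n k f) x 1) /\
  abs_cont_oo01 (derive1n r.-1 f) /\
  (wnorm_r al be lam r f < +oo)%E.

Definition cutoff (psi : R -> R) : Prop :=
  (forall (k : nat) (t : R), derivable (derive1n k psi) t 1) /\
  (forall t, 0 <= psi t <= 1) /\
  (forall t, t <= 0 -> psi t = 0) /\
  (forall t, 1 <= t -> psi t = 1).

Definition Lr (f : R -> R) (n r : nat) (x : R) : R :=
  \sum_(1 <= i < r.+1) f (i%:R / n%:R) *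
    \prod_(1 <= j < r.+1 | j != i)
       ((x - j%:R / n%:R) / (i%:R / n%:R - j%:R / n%:R)).

Definition Rr (f : R -> R) (n r : nat) (x : R) : R :=
  \sum_(1 <= i < r.+1) f (1 - i%:R / n%:R) *
    \prod_(1 <= j < r.+1 | j != i)
       ((x - (1 - j%:R / n%:R)) / ((1 - i%:R / n%:R) - (1 - j%:R / n%:R))).

Definition Fn (psi f : R -> R) (n r : nat) (x : R) : R :=
  let nr := n%:R in
  if x <= 1 / nr then Lr f n r x
  else if x <= 2 / nr then Lr f n r x + psi (nr * x - 1) * (f x - Lr f n r x)
  else if x < 1 - 2 / nr then f x
  else if x < 1 - 1 / nr then Rr f n r x + psi (nr - nr * x - 1) * (f x - Rr f n r x)
  else Rr f n r x.

Definition Bern (m : nat) (g : R -> R) (x : R) : R :=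
  \sum_(0 <= k < m.+1) g (k%:R / m%:R) * 'C(m, k)%:R * x ^+ k * (1 - x) ^+ (m - k).

(* conditions (a)-(d) on n_i = nn n i, C_i(n) = cc n i, i = 0..r-2, constant K *)
Definition comb_family (K : R) (r : nat) (nn : nat -> nat -> nat)
    (cc : nat -> nat -> R) (n : nat) : Prop :=
  [/\ nn n 0%N = n /\ (forall i, (i.+1 < r.-1)%N -> (nn n i < nn n i.+1)%N)
        /\ (nn n (r - 2)%N)%:R <= K * n%:R,
      \sum_(i < r.-1) `|cc n i| <= K,
      \sum_(i < r.-1) cc n i = 1 &
      forall k : nat, (1 <= k)%N -> (k <= r - 2)%N ->
        \sum_(i < r.-1) cc n i * ((nn n i)%:R ^- k) = 0].

Definition Bstar (psi : R -> R) (nn : nat -> nat -> nat) (cc : nat -> nat -> R)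
    (n r : nat) (f : R -> R) (x : R) : R :=
  \sum_(i < r.-1) cc n i * Bern (nn n i) (Fn psi f n r) x.

End Defs.

(* Main.v *)
(** Put W = w phi^(r lam) for the weight. The r-th derivative of a Bernstein
    polynomial of degree m is a multiple, of order m^r, of the Bernstein sum of
    the r-th differences of F_n at the nodes k/m.  Since F_n reproduces
    polynomials of degree < r and is local at scale 1/n, those differences are
    controlled by f on [1/n, 1 - 1/n]: by ||wf|| / w in part (i), and by
    n^(-r) ||W f^(r)|| / W in part (ii), after subtracting a Taylor polynomial.
    At such points 1/W is at most a multiple of
    ((m+1)/(k+1))^a ((m+1)/(m-k+1))^b, and the Bernstein sum of this quantity is
    of order 1/W(x); this gives (ii), and (i) when n x (1 - x) <= 1.  When
    n x (1 - x) > 1, one has X^r p^(r) = q p for X = x (1 - x) and a Bernstein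
    basis polynomial p, with |q| of order
    (m X)^(r/2) (1 + (|k - m x| / sqrt (m X))^r), and the binomial moments are
    bounded.

    In (ii), f^(r-1) is absolutely continuous and f^(r) is controlled only almost
    everywhere, and only where the (totalized) derivative exists.  That f^(r-1) is
    Lipschitz therefore needs its differentiability almost everywhere, which is
    proved by Vitali coverings: the points whose small difference quotients take
    values below p and above q > p, or are unbounded above, form a null set. *)
Require Import Defs.
From HB Require Import structures.
From mathcomp Require Import all_boot all_order all_algebra.
From mathcomp Require Import all_classical all_reals all_analysis.
From mathcomp Require Import ess_sup_inf ring lra zify.
Import Order.TTheory GRing.Theory Num.Theory.
Import numFieldNormedType.Exports.
Local Open Scope classical_set_scope.
Local Open Scope ring_scope.
Set Implicit Arguments. Unset Strict Implicit. Unset Printing Implicit Defensive.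

Section Chain.
Variable R : realType.
Implicit Types (a b : R) (s : seq (R * R)) (g : R -> R).

Fixpoint chain a s b : Prop :=
  if s is p :: s' then [/\ a <= p.1, p.1 <= p.2 & chain p.2 s' b] else a <= b.

Definition len s := \sum_(p <- s) (p.2 - p.1).
Definition inc g s := \sum_(p <- s) (g p.2 - g p.1).
Definition var g s := \sum_(p <- s) `|g p.2 - g p.1|.
Definition cover s : set R := \big[setU/set0]_(p <- s) [set` `[p.1, p.2]].

Fixpoint gaps a s b :=
  if s is p :: s' then (a, p.1) :: gaps p.2 s' b else [:: (a, b)].

Lemma chain_le a s b : chain a s b -> a <= b.
Proof. by elim: s a => //= p s IH a [h1 h2 /IH h3]; lra. Qed.

Lemma chain_mem a s b p : chain a s b -> p \in s -> a <= p.1 /\ p.2 <= b.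
Proof.
elim: s a => //= q s IH a [h1 h2 h3]; rewrite inE => /orP[/eqP->|/(IH _ h3)[]].
  by split => //; exact: chain_le h3.
by split=> //; lra.
Qed.

Lemma chain_widen a' a s b : a' <= a -> chain a s b -> chain a' s b.
Proof. by case: s => /= [|p s] h; [move=> ?; lra | case=> *; split => //; lra]. Qed.

Lemma chain_cat a s c t b : chain a s c -> chain c t b -> chain a (s ++ t) b.
Proof.
elim: s a => /= [|p s IH] a h; first exact: chain_widen.
by case: h => h1 h2 h3 h4; split => //; exact: IH.
Qed.

Lemma chain_gaps a s b : chain a s b -> chain a (gaps a s b) b.
Proof. by elim: s a => //= p s IH a [h1 h2 /IH h]; split => //; exact: chain_widen h. Qed.

Lemma len_ge0 a s b : chain a s b -> 0 <= len s.
Proof.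
elim: s a => [|p s IH] a; first by rewrite /len big_nil.
by move=> /= [h1 h2 /IH h3]; rewrite /len big_cons -/(len s); lra.
Qed.

Lemma len_gaps a s b : len (gaps a s b) = b - a - len s.
Proof.
elim: s a => [|p s IH] a; rewrite /len /= big_cons ?big_nil /=; first by rewrite ?big_nil; ring.
rewrite -/(len _) IH [in RHS]big_cons -/(len s); ring.
Qed.

Lemma inc_gaps g a s b : inc g (gaps a s b) = g b - g a - inc g s.
Proof.
elim: s a => [|p s IH] a; rewrite /inc /= big_cons ?big_nil /=; first by rewrite ?big_nil; ring.
rewrite -/(inc _ _) IH [in RHS]big_cons -/(inc _ s); ring.
Qed.

Lemma inc_le_var g s : `|inc g s| <= var g s.
Proof. exact: ler_norm_sum. Qed.

Lemma chain_filter a s b (Q : pred (R * R)) : chain a s b -> chain a [seq p <- s | Q p] b.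
Proof.
elim: s a => //= p s IH a [h1 h2 h3]; case: ifP => _ /=; first by split => //; exact: IH.
by apply: chain_widen (IH _ h3); lra.
Qed.

Lemma chain_nth a s b k : chain a s b -> (k < size s)%N ->
  let p := nth (0, 0) s k in a <= p.1 /\ p.2 <= b.
Proof. by move=> c ks /=; apply: chain_mem c _; exact: mem_nth. Qed.

Lemma chain_nthS a s b k : chain a s b -> (k.+1 < size s)%N ->
  (nth (0, 0) s k).2 <= (nth (0, 0) s k.+1).1.
Proof.
elim: s a k => //= p s IH a [|k] [_ _ h] ks; last exact: IH h ks.
by case: s h ks {IH} => //= q s [].
Qed.

Lemma abs_cont_chain g a b : abs_cont_on a b g ->
  forall e, 0 < e -> exists2 d, 0 < d &
    forall s, chain a s b -> len s < d -> var g s < e.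
Proof.
move=> gAC e /gAC[d d0 gd]; exists d => // s0 cs0 ls0.
pose s := [seq p <- s0 | p.1 != p.2].
have cs : chain a s b by exact: chain_filter.
have lE : len s0 = len s.
  rewrite /len big_filter [RHS]big_mkcond /=; apply: eq_bigr => p _.
  by case: eqP => //= ->; rewrite subrr.
have vE : var g s0 = var g s.
  rewrite /var big_filter [RHS]big_mkcond /=; apply: eq_bigr => p _.
  by case: eqP => //= ->; rewrite subrr normr0.
have mem12 p : p \in s -> p.1 < p.2.
  rewrite mem_filter => /andP[ne]; rewrite lt_neqAle ne /=.
  elim: (s0) (a) cs0 => //= q s1 IH c [h1 h2 h3].
  by rewrite inE => /orP[/eqP->//|]; exact: IH h3.
have H := gd (size s) (fun k => (nth (0, 0) s k).1) (fun k => (nth (0, 0) s k).2).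
have E (F : R * R -> R) : \sum_(p <- s) F p = \sum_(k < size s) F (nth (0, 0) s k).
  by rewrite (big_nth (0, 0)) big_mkord.
rewrite vE /var E; apply: H => [k ks|k ks|]; last by rewrite -(E (fun p => p.2 - p.1)) -/(len s) -lE.
- have [? ?] := chain_nth cs ks; split => //; split => //.
  by apply: mem12; exact: mem_nth.
- exact: chain_nthS cs ks.
Qed.

Lemma sorted_chain a b s : a <= b -> uniq s -> sorted (fun p q => p.1 <= q.1) s ->
  (forall p, p \in s -> [/\ a <= p.1, p.1 < p.2 & p.2 <= b]) ->
  (forall p q, p \in s -> q \in s -> p != q -> p.2 <= q.1 \/ q.2 <= p.1) ->
  chain a s b.
Proof.
elim: s a => //= p s IH a ab /andP[ps us] so Hm Hd.
have [h1 h2 h3] := Hm p (mem_head _ _); split => //; first exact: ltW.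
have tr : transitive (fun p q : R * R => p.1 <= q.1) by move=> ? ? ?; exact: le_trans.
apply: IH => //; first exact: path_sorted so.
- move=> q qs; have qps : q \in p :: s by rewrite inE qs orbT.
  have [? ? ?] := Hm q qps; split => //.
  have := order_path_min tr so => /allP/(_ q qs) pq.
  have : p != q by apply: contraNneq ps => ->.
  by move=> /(Hd _ _ (mem_head _ _) qps)[//|]; lra.
- by move=> x y xs ys; apply: Hd; rewrite inE ?xs ?ys orbT.
Qed.

End Chain.

Section OuterMeasure.
Variable R : realType.
Implicit Types (a b : R) (s : seq (R * R)) (A B : set R).
Local Open Scope ereal_scope.

Definition outer A : \bar R := ((wlength (@idfun R))^* A)%mu.

Lemma outer_le A B : A `<=` B -> outer A <= outer B.
Proof. by move=> AB; rewrite /outer; exact: le_outer_measure. Qed.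

Lemma outerU A B : outer (A `|` B) <= outer A + outer B.
Proof. rewrite /outer; exact: outer_measureU2. Qed.

Lemma outer_ge0 A : 0 <= outer A.
Proof. rewrite /outer; exact: outer_measure_ge0. Qed.

Lemma outer_cc a b : (a <= b)%R -> outer [set` `[a, b]%R] = (b - a)%:E.
Proof.
move=> ab; rewrite [LHS](lebesgue_measure_itv `[a, b]%R) /= lte_fin -EFinB.
by case: ltP => // ba; rewrite (_ : b = a) ?subrr //; apply/le_anti; rewrite ba ab.
Qed.

Lemma outer_oo a b : (a <= b)%R -> outer [set` `]a, b[%R] = (b - a)%:E.
Proof.
move=> ab; rewrite [LHS](lebesgue_measure_itv `]a, b[%R) /= lte_fin -EFinB.
by case: ltP => // ba; rewrite (_ : b = a) ?subrr //; apply/le_anti; rewrite ba ab.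
Qed.

Lemma coverE s x : cover s x <-> exists2 p, p \in s & (p.1 <= x <= p.2)%R.
Proof.
rewrite /cover -bigcup_seq /=; split => -[p ps H]; exists p => //; move: H; rewrite /= in_itv.
Qed.

Lemma measurable_cover s : measurable (cover s : set (measurableTypeR R)).
Proof. by apply: bigsetU_measurable. Qed.

Lemma len_le_outer a s b : chain a s b -> (len s)%:E <= outer (cover s).
Proof.
elim: s a => [|p s IH] a /=; first by rewrite /len big_nil outer_ge0.
move=> [h1 h2 h3]; rewrite /len big_cons EFinD.
have -> : (p.2 - p.1)%:E = lebesgue_measure ([set` `[p.1, p.2[%R] : set R).
  rewrite (lebesgue_measure_itv `[p.1, p.2[%R) /= lte_fin -EFinB.
  by case: ltP => // ba; rewrite (_ : p.2 = p.1) ?subrr //; apply/le_anti; rewrite ba h2.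
apply: (@le_trans _ _ (lebesgue_measure ([set` `[p.1, p.2[%R] : set R) + lebesgue_measure (cover s))).
  by rewrite leeD2l//; exact: IH h3.
rewrite -measureU //=; last 2 first.
- exact: measurable_cover.
- apply/seteqP; split => x //= [] /[!in_itv]/= /andP[_ xp] /coverE[q qs /andP[qx _]].
  by have [] := chain_mem h3 qs; lra.
apply: outer_le => x [/= /[!in_itv]/= /andP[px xp]|/coverE[q qs qx]]; apply/coverE.
  by exists p; rewrite ?mem_head // px ltW.
by exists q => //; rewrite inE qs orbT.
Qed.

Lemma outer_cover_le s : (forall p, p \in s -> p.1 <= p.2)%R -> outer (cover s) <= (len s)%:E.
Proof.
elim: s => [|p s IH] H; first by rewrite /cover /len !big_nil /outer outer_measure0.
rewrite /cover /len !big_cons EFinD; apply: le_trans (outerU _ _) _.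
rewrite leeD //; first by rewrite outer_cc // H ?mem_head.
by apply: IH => q qs; apply: H; rewrite inE qs orbT.
Qed.

(* Vitali's theorem, with the disjoint finite subfamily presented as a chain. *)
Lemma vitali_chain a b A (Q : R -> R -> Prop) : (a <= b)%R ->
  A `<=` [set` `]a, b[%R] ->
  (forall x, A x -> forall e : R, (0 < e)%R -> exists c r : rat,
     [/\ (0 < (ratr r : R) < e)%R, ((ratr c : R) - ratr r < x < ratr c + ratr r)%R &
         Q (ratr c - ratr r)%R (ratr c + ratr r)%R]) ->
  forall e : R, (0 < e)%R -> exists s, [/\ chain a s b,
    (forall p, p \in s -> p.1 < p.2 /\ Q p.1 p.2)%R & outer (A `\` cover s) < e%:E].
Proof.
move=> ab Aab HA e e0.
have [dec d2 decE] : exists2 dec : nat -> R * R, (forall k, 0 < (dec k).2)%R &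
    forall c r : rat, (0 < (ratr r : R))%R -> exists k, dec k = (ratr c, ratr r).
  exists (fun k => if unpickle k is Some cr then
      (if (0 < (ratr cr.2 : R))%R then (ratr cr.1, ratr cr.2) else (0%R, 1%R)) else (0%R, 1%R)).
    by move=> k; case: unpickle => [cr|] //=; case: ifP.
  by move=> c r r0; exists (pickle (c, r)); rewrite pickleK /= r0.
pose B k := ball (dec k).1 (dec k).2.
have rB k : (radius (B k))%:num = (dec k).2 by rewrite /B radius_ball_num // ltW.
have clB k : closure (B k) = [set` `[(dec k).1 - (dec k).2, (dec k).1 + (dec k).2]%R].
  by rewrite /B closure_ballE closed_ball_itv.
pose F := [set k | a < (dec k).1 - (dec k).2 /\ (dec k).1 + (dec k).2 < b /\
  Q ((dec k).1 - (dec k).2) ((dec k).1 + (dec k).2)]%R.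
have vit : vitali_cover A B F.
  split => [k|x Ax d d0]; first exact: is_ball_ball.
  have := Aab _ Ax; rewrite /= in_itv /= => /andP[ax xb].
  pose d' := (Num.min (d / 2) (Num.min ((x - a) / 2) ((b - x) / 2)))%R.
  have [|c [r [/andP[r0 rd] cx q]]] := HA _ Ax d'; first by rewrite !lt_min; lra.
  have [k dE] := decE c _ r0.
  exists k; move: rd; rewrite !lt_min => /andP[rd /andP[rd1 rd2]].
  rewrite /F rB /= /B dE /=; split; [by split; [lra|split => //; lra]| |].
    by rewrite ball_itv /= in_itv.
  lra.
have muA : lebesgue_measure A < +oo.
  apply: le_lt_trans (outer_le Aab) _; by rewrite outer_oo ?ltry.
have [G0 [GF0 tG0 Ge]] := vitali_theorem_corollary (fun k => etrans (congr1 _ (rB k)) (d2 k)) muA vit e0.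
have GF k : k \in finmap.enum_fset G0 -> F k by exact: GF0.
have tG k l : k \in finmap.enum_fset G0 -> l \in finmap.enum_fset G0 ->
  closure (B k) `&` closure (B l) !=set0 -> k = l by exact: tG0.
have uG : uniq (finmap.enum_fset G0) by exact: finmap.fset_uniq.
move: (finmap.enum_fset G0) Ge GF tG uG => G Ge GF tG uG {G0 GF0 tG0}.
pose iv k := ((dec k).1 - (dec k).2, (dec k).1 + (dec k).2)%R.
pose le1 (p q : R * R) := (p.1 <= q.1)%R.
pose s := sort le1 (map iv G).
have memG p : p \in s -> exists2 k, F k & p = iv k /\ k \in G.
  by rewrite mem_sort => /mapP[k kG ->]; exists k => //; exact: GF.
have disj k l : k \in G -> l \in G -> k != l ->
    ((iv k).2 <= (iv l).1 \/ (iv l).2 <= (iv k).1)%R.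
  move=> kG lG kl; apply: contrapT => /not_orP[/negP h1 /negP h2].
  move: h1 h2; rewrite -!ltNge /= => h1 h2.
  pose z := Num.max ((dec k).1 - (dec k).2)%R ((dec l).1 - (dec l).2)%R.
  have := tG k l kG lG; move=> H; move/eqP: kl; apply; apply: H; exists z; rewrite /= !clB /= !in_itv /= /z.
  have := d2 k; have := d2 l; rewrite !le_max !ge_max !lexx !orbT /=; lra.
have inj : {in G &, injective iv}.
  move=> k l kG lG E; apply: contrapT => /eqP kl.
  by have := disj k l kG lG kl; rewrite /iv in E; case: E; have := d2 k; have := d2 l => /=; lra.
exists s; split.
- apply: sorted_chain => //.
  + by rewrite sort_uniq map_inj_in_uniq //.
  + by apply: sort_sorted => p q; exact: le_total.
  + by move=> p /memG[k [? [? _]] [-> _]] /=; split; have := d2 k; lra.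
  + move=> p q /memG[k _ [-> kG]] /memG[l _ [-> lG]] ne; apply: disj => //.
    by apply: contraNneq ne => ->.
- by move=> p /memG[k [? [? ?]] [-> _]] /=; split => //; have := d2 k; lra.
- apply: le_lt_trans Ge; apply: outer_le; apply: setDS => x.
  rewrite -bigcup_seq => -[k /= kG]; rewrite clB /= in_itv /= => H.
  by apply/coverE; exists (iv k) => //; rewrite mem_sort; apply: map_f.
Qed.
End OuterMeasure.

Section LowerSlopes.
Variable R : realType.
Implicit Types (a b p q x : R) (g : R -> R) (s : seq (R * R)) (A U : set R).

Definition low g p x := forall e, 0 < e -> exists u v,
  [/\ x - e < u <= x, x <= v < x + e, u < v & g v - g u < p * (v - u)].

Lemma abs_cont_eps g a b x e : abs_cont_on a b g -> a < x < b -> 0 < e ->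
  exists2 d, 0 < d & forall y, `|y - x| < d -> `|g y - g x| < e.
Proof.
move=> gAC /andP[ax xb] /(abs_cont_chain gAC)[d d0 H].
exists (Num.min d (Num.min (x - a) (b - x))); first by rewrite !lt_min; lra.
move=> y; rewrite !lt_min => /andP[yd /andP[ya yb]].
have [xy|yx] := leP x y.
- have := H [:: (x, y)]; rewrite /len /var !big_seq1 /=; apply.
    by move: yb; rewrite ger0_norm; [split; lra|lra].
  by move: yd; rewrite ger0_norm; lra.
- rewrite distrC; have := H [:: (y, x)]; rewrite /len /var !big_seq1 /=; apply.
    by move: ya; rewrite ltr0_norm; [split; lra|lra].
  by move: yd; rewrite ltr0_norm; lra.
Qed.

Lemma low_ball g a b p x : abs_cont_on a b g -> a < x < b -> low g p x ->
  forall e, 0 < e -> exists c r : rat,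
     [/\ (0 < (ratr r : R) < e), ((ratr c : R) - ratr r < x < ratr c + ratr r) &
         g (ratr c + ratr r) - g (ratr c - ratr r) < p * ((ratr c + ratr r) - (ratr c - ratr r))].
Proof.
move=> gAC axb lo e e0; have /andP[ax xb] := axb.
pose e1 := Num.min (e / 2) (Num.min (x - a) (b - x)).
have e10 : 0 < e1 by rewrite !lt_min; lra.
have [u [v [/andP[xu ux] /andP[xv vx] uv gp]]] := lo e1 e10.
have e1E : [/\ e1 <= e / 2, e1 <= x - a & e1 <= b - x] by rewrite !ge_min !lexx !orbT.
case: e1E => e1a e1b e1c.
pose h := (p * (v - u) - (g v - g u)) / 4.
have h0 : 0 < h by rewrite /h; lra.
have [|d1 d10 H1] := @abs_cont_eps g a b u h gAC _ h0; first by lra.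
have [|d2 d20 H2] := @abs_cont_eps g a b v h gAC _ h0; first by lra.
pose d := Num.min d1 (Num.min d2 (Num.min (h / (`|p| + 1)) (e / 4))).
have p1 : 0 < `|p| + 1 by have := normr_ge0 p; lra.
have d0 : 0 < d by rewrite !lt_min d10 d20 divr_gt0 //=; lra.
have [al /[!in_itv]/= /andP[ua au]] := @rat_in_itvoo R (u - d) u ltac:(lra).
have [be /[!in_itv]/= /andP[vb bv]] := @rat_in_itvoo R v (v + d) ltac:(lra).
have dE : [/\ d <= d1, d <= d2, d <= h / (`|p| + 1) & d <= e / 4].
  by rewrite !ge_min !lexx !orbT.
case: dE => dd1 dd2 dd3 dd4.
exists ((al + be) / 2), ((be - al) / 2).
have -> : ratr ((al + be) / 2) - ratr ((be - al) / 2) = ratr al :> R.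
  by rewrite -rmorphB /=; congr ratr; field.
have -> : ratr ((al + be) / 2) + ratr ((be - al) / 2) = ratr be :> R.
  by rewrite -rmorphD /=; congr ratr; field.
have -> : ratr ((be - al) / 2) = (ratr be - ratr al) / 2 :> R.
  by rewrite fmorph_div /= rmorphB ratr_nat.
split; [lra|lra|].
have /H1 A1 : `|ratr al - u| < d1 by rewrite ltr0_norm; lra.
have /H2 A2 : `|ratr be - v| < d2 by rewrite gtr0_norm; lra.
have B : `|p * ((ratr be - ratr al) - (v - u))| <= 2 * h.
  rewrite normrM (@ger0_norm _ (_ - _)); last lra.
  have : d * (`|p| + 1) <= h by rewrite -ler_pdivlMr.
  have := normr_ge0 p; nra.
move: A1 A2 B; rewrite !ltr_norml ler_norml => /andP[A1 _] /andP[_ A2] /andP[B _].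
move: B; rewrite mulrBr; rewrite /h in A1 A2 *; lra.
Qed.

Lemma low_chain g a b p A U e : abs_cont_on a b g -> a <= b ->
  A `<=` [set` `]a, b[] -> A `<=` low g p -> open U -> A `<=` U -> 0 < e ->
  exists s, [/\ chain a s b,
    forall r, r \in s -> [/\ r.1 < r.2, r.2 - r.1 < e & g r.2 - g r.1 < p * (r.2 - r.1)],
    cover s `<=` U & (outer (A `\` cover s) < e%:E)%E].
Proof.
move=> gAC ab Aab Alow oU AU e0.
pose Q u v := (v - u < e /\ g v - g u < p * (v - u)) /\ [set` `[u, v]] `<=` U.
have [|s [cs sQ se]] := @vitali_chain R a b A Q ab Aab _ e e0.
  move=> x Ax d d0.
  have [/= f f0 fU] := open_subball oU (AU _ Ax).
  have xab : a < x < b by have := Aab _ Ax; rewrite /= in_itv.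
  have [|c [r [/andP[r0 rd] cx cQ]]] := low_ball gAC xab (Alow _ Ax) (e := Num.min d (Num.min (e / 2) (f / 4))).
    by rewrite !lt_min; lra.
  move: rd; rewrite !lt_min => /andP[rd /andP[re rf]].
  exists c, r; split; rewrite ?r0 //; split; [by split; [lra|]|] => y; rewrite /= in_itv /= => yc.
  apply: (fU (f / 2)) => //=; [|lra|].
    by rewrite sub0r normrN gtr0_norm; lra.
  by rewrite /ball /= ltr_norml; lra.
exists s; split => // [r /sQ[? [[]]]//|x /coverE[r rs rx]].
by have [_ [_]] := sQ _ rs; apply; rewrite /= in_itv.
Qed.

End LowerSlopes.

Section NullSets.
Variable R : realType.
Implicit Types (a b p q x : R) (g : R -> R) (s : seq (R * R)) (A U : set R).

Definition up g q x := low (fun y => - g y) (- q) x.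

Lemma abs_cont_opp g a b : abs_cont_on a b g -> abs_cont_on a b (fun y => - g y).
Proof.
move=> gAC e /gAC[d d0 H]; exists d => // N u v h1 h2 h3.
rewrite (eq_bigr (fun k => `|g (v (nat_of_ord k)) - g (u k)|)); first exact: H.
by move=> k _; rewrite -opprD normrN.
Qed.

Lemma abs_cont_sub g a b u v : a <= u -> v <= b -> abs_cont_on a b g -> abs_cont_on u v g.
Proof.
move=> au vb gAC e /gAC[d d0 H]; exists d => // N x y h1 h2 h3; apply: H => // k /h1.
by move=> [? [? ?]]; split; [|split] => //; lra.
Qed.

Lemma refill1 g a b u v q A h : abs_cont_on a b g -> a <= u -> u <= v -> v <= b ->
  A `<=` up g q -> 0 < h -> exists s, [/\ chain u s v, q * len s <= inc g s &
    (outer (A `&` [set` `[u, v]]) <= (len s + h)%:E)%E].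
Proof.
move=> gAC au uv vb Aup h0.
pose A' := A `&` [set` `]u, v[].
have [||||||s [cs sQ _ se]] := @low_chain R (fun y => - g y) u v (- q) A' setT h _ uv.
- by apply: abs_cont_opp; exact: abs_cont_sub gAC.
- by move=> x [].
- by move=> x [/Aup].
- exact: openT.
- by [].
- by [].
exists s; split => //.
  rewrite /len /inc mulr_sumr; rewrite big_seq [leRHS]big_seq; apply: ler_sum => r rs.
  by have [_ _] := sQ _ rs; lra.
apply: (@le_trans _ _ (outer ((A' `\` cover s) `|` cover ((u, u) :: (v, v) :: s)))).
  apply: outer_le => x [Ax]; rewrite /= in_itv /= => /andP[ux xv].
  have [xs|xs] := pselect (cover s x).
    right; move/coverE: xs => [r rs rx]; apply/coverE; exists r => //.
    by rewrite !inE rs !orbT.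
  have [->|ne1] := eqVneq x u.
    by right; apply/coverE; exists (u, u); rewrite ?inE ?eqxx //= lexx.
  have [->|ne2] := eqVneq x v.
    by right; apply/coverE; exists (v, v); rewrite ?inE ?eqxx ?orbT //= lexx.
  left; split => //; split => //; rewrite /= in_itv /= !lt_neqAle ux xv.
  by rewrite eq_sym ne1 ne2.
apply: (le_trans (outerU _ _)).
rewrite addrC EFinD leeD //; last exact: ltW.
apply: le_trans (outer_cover_le _) _.
  move=> r; rewrite !inE => /or3P[/eqP->|/eqP->|/sQ[/ltW]]//=.
by rewrite /len !big_cons /= !subrr !add0r.
Qed.

Lemma refill g a b q A h s : abs_cont_on a b g -> chain a s b ->
  A `<=` up g q -> 0 < h -> exists (t : seq (R * R)) (l : R),
   [/\ chain a t b, len t = len s - l, q * l <= inc g s + var g t &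
    (outer (A `&` cover s) <= (l + (size s)%:R * h)%:E)%E].
Proof.
move=> + + Aup h0; elim: s a => [|p s IH] a gAC /=.
  move=> ab; exists [::], 0; split => //; rewrite /len /inc /var ?big_nil /=.
  - by rewrite subr0.
  - by rewrite mulr0 addr0.
  - by rewrite /cover big_nil setI0 mul0r addr0 /outer outer_measure0.
move=> [ap p12 cs]; have pb := chain_le cs.
have [t0 [ct0 q0 o0]] := refill1 gAC ap p12 pb Aup h0.
have [|t [l [ct lt ql o]]] := IH p.2 _ cs; first by apply: abs_cont_sub gAC => //; lra.
exists (gaps p.1 t0 p.2 ++ t), (len t0 + l); split.
- by apply: chain_cat ct; apply: chain_widen ap _; exact: chain_gaps.
- have := len_gaps p.1 t0 p.2; rewrite /len in lt *; rewrite big_cat big_cons /= => ->.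
  by rewrite lt /len; lra.
- have := inc_gaps g p.1 t0 p.2; have := inc_le_var g (gaps p.1 t0 p.2).
  rewrite ler_norml => /andP[+ _]; rewrite /var big_cat /= -/(var g _) -/(var g t).
  by rewrite /inc big_cons -/(inc g s) -/(inc g t0) -/(inc g _); lra.
- have -> : A `&` cover (p :: s) = (A `&` [set` `[p.1, p.2]]) `|` (A `&` cover s).
    by rewrite /cover big_cons setIUr.
  apply: le_trans (outerU _ _) _; apply: le_trans (leeD o0 o) _.
  by rewrite -EFinD lee_fin -addn1 natrD; lra.
Qed.

Lemma outer_fin a b A : a <= b -> A `<=` [set` `]a, b[] -> (outer A \is a fin_num)%E.
Proof.
move=> ab Aab; rewrite ge0_fin_numE ?outer_ge0 //; apply: le_lt_trans (outer_le Aab) _.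
by rewrite outer_oo // ltry.
Qed.

Lemma low_up_null g a b p q : abs_cont_on a b g -> a <= b -> 0 < p -> p < q ->
  outer ([set` `]a, b[] `&` low g p `&` up g q) = 0%E.
Proof.
move=> gAC ab p0 pq; set A := _ `&` _.
have Aab : A `<=` [set` `]a, b[] by move=> x [[]].
have Af := outer_fin ab Aab.
pose m := fine (outer A); have mE : outer A = m%:E by rewrite fineK.
have m0 : 0 <= m by rewrite -lee_fin -mE outer_ge0.
suff H e : 0 < e -> (q - p) * m <= (p + 2 * q + 1) * e.
  rewrite mE; congr EFin; apply/le_anti/andP; split => //.
  rewrite leNgt; apply/negP => m1.
  have c0 : 0 < 2 * (p + 2 * q + 1) by lra.
  have := H ((q - p) * m / (2 * (p + 2 * q + 1))).
  have d0 : 0 < (q - p) * m by rewrite mulr_gt0 //; lra.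
  rewrite divr_gt0 // => /(_ isT).
  have -> : (p + 2 * q + 1) * ((q - p) * m / (2 * (p + 2 * q + 1))) = (q - p) * m / 2.
    by field; lra.
  by lra.
move=> e0.
have [d d0 Hd] := abs_cont_chain gAC e0.
pose h := Num.min e (d / 4).
have h0 : 0 < h by rewrite lt_min; lra.
have [he hd] : h <= e /\ h <= d / 4 by rewrite /h !ge_min !lexx !orbT.
have [U [oU AU Um]] := outer_measure_open_le A h0.
have Alow : A `<=` low g p by move=> x [[]].
have [s [cs sQ sU se]] := low_chain gAC ab Aab Alow oU AU h0.
have lsm : len s <= m + h.
  rewrite -lee_fin EFinD -mE; apply: le_trans (len_le_outer cs) _.
  exact: le_trans (outer_le sU) Um.
have Aup : A `<=` up g q by move=> x [].
have h10 : 0 < h / (size s).+1%:R by rewrite divr_gt0 ?ltr0n.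
have [t [l [ct lt ql lo]]] := refill gAC cs Aup h10.
have ml : m <= l + 2 * h.
  rewrite -lee_fin -mE; have -> : A = (A `\` cover s) `|` (A `&` cover s).
    by rewrite setUC setUIDK.
  apply: le_trans (outerU _ _) _; apply: le_trans (leeD (ltW se) lo) _.
  rewrite -EFinD lee_fin.
  have : (size s)%:R * (h / (size s).+1%:R) <= h.
    by rewrite mulrCA ger_pMr // ler_pdivrMr ?ltr0n // mul1r ler_nat.
  by move: ((size s)%:R * _) => z; lra.
have vt : var g t < e by apply: Hd => //; lra.
have inp : inc g s <= p * len s.
  rewrite /len /inc mulr_sumr; rewrite big_seq [leRHS]big_seq; apply: ler_sum => r rs.
  by have [_ _] := sQ _ rs; lra.
have : q * (m - 2 * h) <= q * l by rewrite ler_pM2l; lra.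
have : p * len s <= p * (m + h) by rewrite ler_pM2l.
have : (p + 2 * q) * h <= (p + 2 * q) * e by rewrite ler_pM2l //; lra.
by lra.
Qed.

Lemma subchain a b s h : chain a s b -> (forall r, r \in s -> r.2 - r.1 < h) ->
  0 < h -> 2 * h <= len s ->
  exists t, [/\ chain a t b, {subset t <= s}, h <= len t & len t < 2 * h].
Proof.
elim: s a => [|p s IH] a /=; first by rewrite /len big_nil; lra.
move=> [ap p12 cs] H h0 hs.
have ps := H p (mem_head _ _).
have H' r : r \in s -> r.2 - r.1 < h by move=> rs; apply: H; rewrite inE rs orbT.
have cs' : chain a s b by apply: chain_widen cs; lra.
have [le2|gt2] := leP (2 * h) (len s).
  have [t [ct ts t1 t2]] := IH a cs' H' h0 le2.
  by exists t; split => // x /ts xs; rewrite inE xs orbT.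
exists s; split => //; first by move=> x xs; rewrite inE xs orbT.
by move: hs; rewrite /len big_cons -/(len s); lra.
Qed.

Lemma up_all_null g a b : abs_cont_on a b g -> a <= b ->
  outer ([set` `]a, b[] `&` [set x | forall M, 0 < M -> up g M x]) = 0%E.
Proof.
move=> gAC ab; set A := _ `&` _.
have Aab : A `<=` [set` `]a, b[] by move=> x [].
apply/le_anti/andP; split; last exact: outer_ge0.
apply/lee_addgt0Pr => e e0; rewrite add0e.
have [d d0 Hd] := abs_cont_chain gAC ltr01.
pose h := Num.min (e / 3) (d / 2).
have h0 : 0 < h by rewrite lt_min; lra.
have [he hd] : h <= e / 3 /\ h <= d / 2 by rewrite /h !ge_min !lexx !orbT.
have hi : 0 < h^-1 by rewrite invr_gt0.
have Aup : A `<=` up g h^-1 by move=> x [_]; apply.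
have [s [cs sQ _ se]] := low_chain (abs_cont_opp gAC) ab Aab Aup openT (@subsetT _ A) h0.
have ls : len s < 2 * h.
  rewrite ltNge; apply/negP => sh.
  have [t [ct ts t1 t2]] := subchain cs (fun r rs => let: And3 _ h2 _ := sQ r rs in h2) h0 sh.
  have vt : var g t < 1 by apply: Hd => //; lra.
  have : h^-1 * len t <= inc g t.
    rewrite /len /inc mulr_sumr; rewrite big_seq [leRHS]big_seq; apply: ler_sum => r /ts rs.
    by have [_ _] := sQ _ rs; lra.
  have : h^-1 * h <= h^-1 * len t by rewrite ler_pM2l.
  rewrite mulVf ?gt_eqF //.
  by have := le_trans (ler_norm _) (inc_le_var g t); lra.
apply: (@le_trans _ _ (outer ((A `\` cover s) `|` cover s))).
  by apply: outer_le => x Ax; have [xs|xs] := pselect (cover s x); [right|left].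
apply: le_trans (outerU _ _) _.
apply: (@le_trans _ _ (h%:E + (2 * h)%:E)%E).
  apply: leeD; first exact: ltW.
  apply: le_trans (outer_cover_le _) _; last by rewrite lee_fin ltW.
  by move=> r /sQ[/ltW].
by rewrite -EFinD lee_fin; lra.
Qed.

End NullSets.

Section Lipschitz.
Variable R : realType.
Implicit Types (a b p q x : R) (g : R -> R).

Lemma notlow g p x : ~ low g p x -> exists2 e, 0 < e & forall u v,
  x - e < u <= x -> x <= v < x + e -> u < v -> p * (v - u) <= g v - g u.
Proof.
move=> /existsNP[e /not_implyP[e0 H]]; exists e => // u v hu hv uv.
by rewrite leNgt; apply/negP => h; apply: H; exists u, v.
Qed.

Lemma notup g q x : ~ up g q x -> exists2 e, 0 < e & forall u v,
  x - e < u <= x -> x <= v < x + e -> u < v -> g v - g u <= q * (v - u).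
Proof.
move=> /notlow[e e0 H]; exists e => // u v hu hv uv; have := H u v hu hv uv; lra.
Qed.

Lemma slopes_derivable g x p0 : 0 < p0 -> ~ low g p0 x ->
  ~ (forall M, 0 < M -> up g M x) ->
  (forall p q : rat, 0 < (ratr p : R) -> (ratr p : R) < ratr q ->
     ~ (low g (ratr p) x /\ up g (ratr q) x)) ->
  derivable g x 1 /\ p0 <= derive1 g x.
Proof.
move=> p00 nlow /existsNP[M /not_implyP[M0 /notup[eM eM0 HM]]] npq.
pose S := [set p | ~ low g p x].
have hS : has_sup S.
  split; first by exists p0.
  exists M => p /notlow[e e0 H].
  pose h := Num.min e eM.
  have h0 : 0 < h by rewrite lt_min e0 eM0.
  have [he hM] : h <= e /\ h <= eM by rewrite /h !ge_min !lexx !orbT.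
  have h1 : p * (x + h / 2 - x) <= g (x + h / 2) - g x by apply: H; lra.
  have h2 : g (x + h / 2) - g x <= M * (x + h / 2 - x) by apply: HM; lra.
  have := le_trans h1 h2; rewrite ler_pM2r //; lra.
pose l := sup S.
have p0l : p0 <= l by apply: sup_upper_bound.
suff cvl : (fun h : R => h^-1 *: (g (h *: (1 : R) + x) - g x)) @ 0^' --> l.
  have dg : derivable g x 1 by apply/cvg_ex; exists l.
  by split => //; rewrite derive1E /derive (cvg_lim _ cvl).
apply/cvgrPdist_le => e e0.
have [p Sp pl] := sup_adherent e0 hS.
have [e1 e10 H1] := notlow Sp.
have [r /[!in_itv]/= /andP[lr re]] := @rat_in_itvoo R l (l + e) ltac:(lra).
have [q /[!in_itv]/= /andP[rq qe]] := @rat_in_itvoo R (ratr r) (l + e) re.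
have lowr : low g (ratr r) x.
  apply: contrapT => nr; have : ratr r <= l by apply: sup_upper_bound.
  by lra.
have [e2 e20 H2] : exists2 e, 0 < e & forall u v,
  x - e < u <= x -> x <= v < x + e -> u < v -> g v - g u <= ratr q * (v - u).
  by apply: notup => upq; apply: (npq r q) => //; lra.
pose d := Num.min e1 e2.
have d0 : 0 < d by rewrite lt_min e10 e20.
have [d1 d2] : d <= e1 /\ d <= e2 by rewrite /d !ge_min !lexx !orbT.
exists d => //= h; rewrite /ball_ /= sub0r normrN => hd hn0.
rewrite -[h *: 1]/(h * 1) mulr1 -[h^-1 *: _]/(h^-1 * _).
have {}pl : l - e < p by rewrite /l.
have [h0|h0|h0] := ltgtP h 0; last by move/eqP: hn0.
- move: hd; rewrite ltr0_norm // => hd.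
  have A1 := H1 (h + x) x ltac:(lra) ltac:(lra) ltac:(lra).
  have A2 := H2 (h + x) x ltac:(lra) ltac:(lra) ltac:(lra).
  have E : (g (h + x) - g x) = h * (h^-1 * (g (h + x) - g x)) by rewrite mulVKf ?lt_eqF.
  rewrite distrC ler_norml; move: (h^-1 * _) E => z E.
  have B1 : p <= z by rewrite -(ler_nM2l h0); lra.
  have B2 : z <= ratr q by rewrite -(ler_nM2l h0); lra.
  by lra.
- move: hd; rewrite gtr0_norm // => hd.
  have A1 := H1 x (h + x) ltac:(lra) ltac:(lra) ltac:(lra).
  have A2 := H2 x (h + x) ltac:(lra) ltac:(lra) ltac:(lra).
  have E : (g (h + x) - g x) = h * (h^-1 * (g (h + x) - g x)) by rewrite mulVKf ?gt_eqF.
  rewrite distrC ler_norml; move: (h^-1 * _) E => z E.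
  have B1 : p <= z by rewrite -(ler_pM2l h0); lra.
  have B2 : z <= ratr q by rewrite -(ler_pM2l h0); lra.
  by lra.
Qed.

Lemma abs_cont_upper g a b D : abs_cont_on a b g -> a <= b -> 0 <= D ->
  {ae @lebesgue_measure R, forall x, a < x < b -> derivable g x 1 -> derive1 g x <= D} ->
  g b - g a <= D * (b - a).
Proof.
move=> gAC ab D0 /negligible_outer_measure.
set N := ~` _ => N0.
apply/ler_addgt0Pr => e e0.
pose h := e / (b - a + 1) / 2.
have ba1 : 0 < b - a + 1 by lra.
have h0 : 0 < h by rewrite !divr_gt0.
pose p0 := D + h.
have p00 : 0 < p0 by rewrite /p0; lra.
pose I : set R := [set` `]a, b[].
have [F F0 FE] : exists2 F : nat -> set R, (forall k, (@lebesgue_measure R).-negligible (F k)) &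
    forall p q : rat, 0 < (ratr p : R) -> (ratr p : R) < ratr q ->
    exists k, F k = I `&` low g (ratr p) `&` up g (ratr q).
  exists (fun k => if unpickle k is Some pq then
      (if (0 < (ratr pq.1 : R)) && ((ratr pq.1 : R) < ratr pq.2)
      then I `&` low g (ratr pq.1) `&` up g (ratr pq.2) else set0) else set0).
    move=> k; apply/negligible_outer_measure.
    case: unpickle => [[p q]|]; last by rewrite outer_measure0.
    case: ifP => [/andP[? ?]|_]; last by rewrite outer_measure0.
    exact: low_up_null.
  by move=> p q p1 pq; exists (pickle (p, q)); rewrite pickleK p1 pq.
pose A := I `&` low g p0.
have IA : (outer (I `\` A) = 0)%E.
  apply/negligible_outer_measure.
  apply: (@negligibleS _ _ _ _ (N `|` ((I `&` [set x | forall M, 0 < M -> up g M x]) `|` \bigcup_k F k))).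
    move=> x [Ix nA].
    have [?|nM] := pselect (forall M, 0 < M -> up g M x); first by right; left.
    have [?|nF] := pselect ((\bigcup_k F k) x); first by right; right.
    left => /= xN.
    have xab : a < x < b by move: Ix; rewrite /I /= in_itv.
    have [] := @slopes_derivable g x p0 p00 _ nM.
    - by move=> lx; apply: nA.
    - move=> p q p1 pq [lp uq]; apply: nF; have [k Fk] := FE p q p1 pq.
      by exists k => //; rewrite Fk.
    - by move=> dg; have := xN xab dg; rewrite /p0; lra.
  apply: negligibleU; first by apply/negligible_outer_measure.
  apply: negligibleU; last exact: negligible_bigcup.
  by apply/negligible_outer_measure; exact: up_all_null.
have e20 : 0 < e / 2 by lra.
have [d d0 Hd] := abs_cont_chain gAC e20.
have d20 : 0 < d / 2 by lra.
have [s [cs sQ _ se]] := @low_chain R g a b p0 A setT (d / 2) gAC ab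
  (@subIsetl _ _ _) (@subIsetr _ _ _) openT (@subsetT _ _) d20.
have lb : b - a <= len s + d / 2.
  rewrite -lee_fin -(outer_oo ab).
  apply: (@le_trans _ _ (outer ((I `\` A) `|` ((A `\` cover s) `|` cover s)))).
    apply: outer_le => x Ix; have [xA|xA] := pselect (A x); last by left.
    by right; have [?|?] := pselect (cover s x); [right|left].
  apply: le_trans (outerU _ _) _; rewrite IA add0e.
  apply: le_trans (outerU _ _) _; rewrite addrC EFinD leeD //; last exact: ltW.
  by apply: outer_cover_le => r /sQ[/ltW].
have cg := chain_gaps cs.
have := len_gaps a s b; have := inc_gaps g a s b.
have := inc_le_var g (gaps a s b); rewrite ler_norml => /andP[_ i1] i2 i3.
have vg : var g (gaps a s b) < e / 2 by apply: Hd => //; rewrite i3; lra.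
have lg := len_ge0 cg.
have is_ : inc g s <= p0 * len s.
  rewrite /len /inc mulr_sumr big_seq [leRHS]big_seq; apply: ler_sum => r rs.
  by have [_ _] := sQ _ rs; lra.
have : p0 * len s <= p0 * (b - a) by rewrite ler_pM2l //; lra.
have : h * (b - a + 1) = e / 2 by rewrite /h; field; lra.
by rewrite /p0 in is_ *; lra.
Qed.

Lemma derive1_opp_derivable g x : derivable g x 1 -> derive1 (fun y => - g y) x = - derive1 g x.
Proof. by move=> dg; rewrite !derive1E -(deriveN dg). Qed.

Theorem abs_cont_lipschitz g a b D : abs_cont_on a b g -> a <= b -> 0 <= D ->
  {ae @lebesgue_measure R, forall x, a < x < b -> `|derive1 g x| <= D} ->
  `|g b - g a| <= D * (b - a).
Proof.
move=> gAC ab D0 H; rewrite ler_norml; apply/andP; split; last first.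
  apply: abs_cont_upper => //.
  apply: (@filterS _ _ (ae_filter_ringOfSetsType _) _ _ _ H) => x Hx xab _.
  move: Hx => /(_ xab); exact: le_trans (ler_norm _).
suff : (- g b) - (- g a) <= D * (b - a) by lra.
apply: (@abs_cont_upper (fun y => - g y)); [exact: abs_cont_opp|by []|by []|].
apply: (@filterS _ _ (ae_filter_ringOfSetsType _) _ _ _ H) => x Hx xab dg.
have dg' : derivable g x 1.
  have -> : g = (fun y => - (- g y)) by apply/funext => y; rewrite opprK.
  exact: derivableN.
rewrite derive1_opp_derivable //.
have := Hx xab; rewrite ler_norml; lra.
Qed.

End Lipschitz.

Section Taylor.
Variable R : realType.
Implicit Types (f : R -> R) (P : {poly R}) (a b c D : R).

Lemma poly_primitive P : exists Q : {poly R}, (size Q <= (size P).+1)%N /\ Q^`() = P.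
Proof.
exists (\poly_(i < (size P).+1) (P`_i.-1 / i%:R)); split; first exact: size_poly.
apply/polyP => i; rewrite coef_deriv coef_poly ltnS /=.
case: ltnP => [iP|Pi]; last by rewrite mul0rn nth_default.
by rewrite -[RHS](@mulfVK _ i.+1%:R) ?pnatr_eq0 // mulr_natr.
Qed.

Lemma derive1n_derive1 f n x : derive1n n (derive1 f) x = derive1n n.+1 f x.
Proof. by rewrite /derive1n -iterSr. Qed.

(* Iterated mean value theorem applied to f minus successive primitives of a constant. *)
Lemma taylor_lip r f a b c D : a <= c <= b ->
  (forall k x, (k < r)%N -> a <= x <= b -> derivable (derive1n k f) x 1) ->
  (forall x y, a <= x <= b -> a <= y <= b ->
     `|derive1n r f x - derive1n r f y| <= D * `|x - y|) ->
  exists P, (size P <= r.+1)%N /\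
    forall x, a <= x <= b -> `|f x - P.[x]| <= D * `|x - c| ^+ r.+1.
Proof.
move=> hc; elim: r f => [|r IH] f hd hl.
  exists (f c)%:P; split; first by rewrite size_polyC leq_b1.
  by move=> x hx; rewrite hornerC expr1; exact: hl.
have [||P [sP HP]] := IH (derive1 f).
- move=> k x kr hx; rewrite (_ : derive1n k _ = derive1n k.+1 f); first exact: hd.
  by apply/funext => y; exact: derive1n_derive1.
- by move=> x y hx hy; rewrite !derive1n_derive1; exact: hl.
have [Q [sQ dQ]] := poly_primitive P.
pose Q' := Q + (f c - Q.[c])%:P.
exists Q'; split.
  apply: leq_trans (size_polyD _ _) _; rewrite geq_max (leq_trans sQ) //=.
  by rewrite (leq_trans (size_polyC_leq1 _)).
have D0 : 0 <= D \/ a = b.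
  have [->|ab] := eqVneq a b; first by right.
  left; have altb : a < b by rewrite lt_neqAle ab; lra.
  have := hl a b; rewrite !lexx /= => /(_ ltac:(lra) ltac:(lra)) H.
  have n0 : 0 < `|a - b| by rewrite normr_gt0; lra.
  by rewrite -(pmulr_lge0 D n0); apply: le_trans H.
pose h x := f x - Q'.[x].
have hder x : a <= x <= b -> is_derive x 1 h (derive1 f x - P.[x]).
  move=> hx; have fx : is_derive x 1 f (derive1 f x).
    by apply: DeriveDef; rewrite ?derive1E //; apply: (hd 0).
  have qx : is_derive x 1 (horner Q') P.[x].
    have := is_derive_poly Q' x; rewrite /Q' derivD derivC addr0 dQ.
    by [].
  exact: is_deriveB.
have hc0 : h c = 0 by rewrite /h /Q' hornerD hornerC; ring.
have hcont u v : a <= u -> v <= b -> {within [set` `[u, v]], continuous h}.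
  move=> au vb; apply: derivable_within_continuous => x /[!in_itv]/= hx.
  by apply: (@ex_derive _ _ _ _ _ _ _ (hder x _)); lra.
move=> x hx; rewrite -/(h x).
have dx0 : 0 <= D * `|x - c| ^+ r.+1.
  have [D0'|E] := D0; first by rewrite mulr_ge0 // exprn_ge0.
  have -> : x = c by lra.
  by rewrite subrr normr0 expr0n mulr0.
have bnd t : `|t - c| <= `|x - c| -> a <= t <= b -> `|derive1 f t - P.[t]| <= D * `|x - c| ^+ r.+1.
  move=> tc ht; apply: le_trans (HP _ ht) _.
  have [D0'|E] := D0; first by rewrite ler_wpM2l // lerXn2r // nnegrE.
  have -> : t = c by lra.
  by rewrite subrr normr0 expr0n mulr0.
rewrite exprS mulrCA mulrC.
have [cx|xc] := leP c x.
- have [|t /[!in_itv]/= ht] := @MVT_segment R h (fun t => derive1 f t - P.[t]) c x cx _ (hcont c x ltac:(lra) ltac:(lra)).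
    by move=> t /[!in_itv]/= ht; apply: hder; lra.
  rewrite hc0 subr0 => ->; rewrite normrM ler_wpM2r //; apply: bnd; last lra.
  by rewrite !ger0_norm; lra.
- have [|t /[!in_itv]/= ht] := @MVT_segment R h (fun t => derive1 f t - P.[t]) x c (ltW xc) _ (hcont x c ltac:(lra) ltac:(lra)).
    by move=> t /[!in_itv]/= ht; apply: hder; lra.
  rewrite hc0 sub0r => /eqP; rewrite eqr_oppLR => /eqP ->.
  rewrite normrN normrM (distrC c x) ler_wpM2r //; apply: bnd; last lra.
  by rewrite !ler0_norm; lra.
Qed.
End Taylor.

Section Lagrange.
Variable R : realType.
Implicit Types (f g : R -> R) (a : nat -> R) (P : {poly R}) (x c E : R) (r n i j k : nat).

Definition lag a r f x : R := \sum_(1 <= i < r.+1) f (a i) *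
  \prod_(1 <= j < r.+1 | j != i) ((x - a j) / (a i - a j)).

Lemma lagB a r f g x : lag a r f x - lag a r g x = lag a r (fun t => f t - g t) x.
Proof. by rewrite /lag -sumrB; apply: eq_bigr => i _; rewrite mulrBl. Qed.

Lemma lag_poly a r P x :
  (forall i j, (1 <= i < r.+1)%N -> (1 <= j < r.+1)%N -> i != j -> a i != a j) ->
  (size P <= r)%N -> lag a r (horner P) x = P.[x].
Proof.
move=> ainj sP.
pose l i : {poly R} := \prod_(1 <= j < r.+1 | j != i) ((a i - a j)^-1 *: ('X - (a j)%:P)).
have sl i : (1 <= i < r.+1)%N -> (size (l i) <= r)%N.
  move=> hi; rewrite /l.
  have H (s : seq nat) : (size (\prod_(j <- s | j != i) ((a i - a j)^-1 *: ('X - (a j)%:P)) : {poly R})%R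
      <= (count (predC1 i) s).+1)%N.
    elim: s => [|j s IH]; first by rewrite big_nil size_poly1.
    rewrite big_cons /=; case: ifP => // _.
    apply: leq_trans (size_polyMleq _ _) _.
    have : (size ((a i - a j)^-1 *: ('X - (a j)%:P) : {poly R})%R <= 2)%N.
      by apply: leq_trans (size_scale_leq _ _) _; rewrite size_XsubC.
    move: (size _) (size _) (count _ _) IH => u v w; rewrite /= ; lia.
  apply: leq_trans (H _) _.
  have := count_predC (pred1 i) (index_iota 1 r.+1).
  rewrite count_uniq_mem ?iota_uniq // mem_index_iota hi size_iota /= => E.
  rewrite (eq_count (a2 := predC (pred1 i))) //; rewrite subSS subn0 in E; rewrite -[X in (_ < X)%N]E add1n ltnS; exact: leqnn.
pose Q : {poly R} := \sum_(1 <= i < r.+1) P.[a i] *: l i.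
have lE i y : (l i).[y] = \prod_(1 <= j < r.+1 | j != i) ((y - a j) / (a i - a j)).
  rewrite /l horner_prod; apply: eq_bigr => j _.
  by rewrite hornerZ hornerXsubC mulrC.
have QE y : Q.[y] = lag a r (horner P) y.
  by rewrite /Q horner_sum /lag; apply: eq_bigr => i _; rewrite hornerZ lE.
have lk i k : (1 <= i < r.+1)%N -> (1 <= k < r.+1)%N -> (l i).[a k] = (k == i)%:R.
  move=> hi hk; rewrite lE; have [->|ne] := eqVneq k i.
    rewrite big_nat_cond big1 // => j /andP[hj ne].
    by rewrite divff // subr_eq0 ainj // eq_sym.
  rewrite big_mkcond (bigD1_seq k) ?mem_index_iota ?iota_uniq //= ne.
  by rewrite subrr !mul0r.
have Q0 : Q - P = 0.
  apply: (@roots_geq_poly_eq0 _ _ [seq a k | k <- index_iota 1 r.+1]).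
  - apply/allP => y /mapP[k]; rewrite mem_index_iota => hk ->.
    rewrite rootE hornerD hornerN /Q horner_sum (bigD1_seq k) ?mem_index_iota ?iota_uniq //=.
    rewrite hornerZ lk // eqxx mulr1 big_nat_cond big1 ?addr0 ?subrr // => i /andP[hi ne].
    by rewrite hornerZ lk // eq_sym (negPf ne) mulr0.
  - rewrite map_inj_in_uniq ?iota_uniq // => i k; rewrite !mem_index_iota => hi hk.
    by apply: contra_eq; exact: ainj.
  - rewrite size_map size_iota subSS subn0.
    apply: leq_trans (size_polyD _ _) _; rewrite size_polyN geq_max sP andbT.
    apply: leq_trans (size_sum _ _ _) _; apply/bigmax_leqP_seq => i; rewrite mem_index_iota => hi _.
    by apply: leq_trans (size_scale_leq _ _) _; exact: sl.
by rewrite -QE; move/eqP: Q0; rewrite subr_eq0 => /eqP ->.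
Qed.

Lemma lag_bound a r f x c E : 1 <= c ->
  (forall i j, (1 <= i < r.+1)%N -> (1 <= j < r.+1)%N -> i != j ->
     `|(x - a j) / (a i - a j)| <= c) ->
  (forall i, (1 <= i < r.+1)%N -> `|f (a i)| <= E) ->
  `|lag a r f x| <= r%:R * c ^+ r * E.
Proof.
move=> c1 hc hE; apply: le_trans (ler_norm_sum _ _ _) _.
have -> : r%:R * c ^+ r * E = \sum_(1 <= i < r.+1) (E * c ^+ r).
  by rewrite sumr_const_nat subSS subn0 -mulr_natl; ring.
rewrite !big_nat; apply: ler_sum => i hi.
rewrite normrM ler_pM // ?hE // normr_prod.
have -> : c ^+ r = \prod_(1 <= j < r.+1) c by rewrite prodr_const_nat subSS subn0.
rewrite big_mkcond !big_nat; apply: ler_prod => j hj.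
by case: ifP => ne; rewrite ?normr_ge0 ?ler01 ?c1 //= hc // eq_sym.
Qed.

Definition lag_const r : R := r%:R * (r.+2)%:R ^+ r + 1.

Lemma Fn_near r n psi f P x E : (2 <= r)%N -> (r < n)%N -> (4 <= n)%N ->
  (forall t, 0 <= psi t <= 1) -> (size P <= r)%N -> 0 <= x <= 1 ->
  (forall t, 1 / n%:R <= t <= 1 - 1 / n%:R -> `|t - x| <= r.+2%:R / n%:R -> `|f t - P.[t]| <= E) ->
  `|Fn psi f n r x - P.[x]| <= lag_const r * E.
Proof.
move=> r2 rn n4 hpsi sP hx HE.
have n0 : 0 < n%:R :> R by rewrite ltr0n; lia.
have n0' : n%:R != 0 :> R by rewrite gt_eqF.
have r0 : 2 <= r%:R :> R by rewrite ler_nat.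
have rn' : r%:R + 1 <= n%:R :> R by rewrite natr1 ler_nat.
have n4' : 4 <= n%:R :> R by rewrite ler_nat.
have rE : r.+2%:R = r%:R + 2 :> R by rewrite -addn2 natrD.
have sc (y : R) : n%:R * (y / n%:R) = y by rewrite mulrCA divff // mulr1.
have inv4 : 4 * (1 / n%:R) <= 1 :> R by rewrite -(ler_pM2l n0) mulrCA sc; lra.
have inv0 : 0 < 1 / n%:R :> R by rewrite divr_gt0.
have rinv : 1 / n%:R <= r.+2%:R / n%:R :> R by rewrite ler_pM2r ?invr_gt0 // ler1n.
have E0 : 0 <= E.
  have [t t1 t2] : exists2 t : R, 1 / n%:R <= t <= 1 - 1 / n%:R & `|t - x| <= 1 / n%:R.
    have [h|h] := leP x (1 / n%:R); first by exists (1 / n%:R); rewrite ?ler_norml; lra.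
    have [h'|h'] := leP x (1 - 1 / n%:R); first by exists x; rewrite ?ler_norml; lra.
    by exists (1 - 1 / n%:R); rewrite ?ler_norml; lra.
  exact: le_trans (normr_ge0 _) (HE t t1 (le_trans t2 rinv)).
have lagf a : (forall i j, (1 <= i < r.+1)%N -> (1 <= j < r.+1)%N -> i != j ->
     `|(x - a j) / (a i - a j)| <= r.+2%:R /\ a i != a j) ->
   (forall i, (1 <= i < r.+1)%N -> `|f (a i) - P.[a i]| <= E) ->
   `|lag a r f x - P.[x]| <= r%:R * r.+2%:R ^+ r * E.
  move=> H1 H2; rewrite -(@lag_poly a r P x) //; last by move=> i j hi hj ij; have [] := H1 i j hi hj ij.
  rewrite lagB; apply: lag_bound => //; first by rewrite ler1n.
  by move=> i j hi hj ij; have [] := H1 i j hi hj ij.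
have mix (s l y : R) : 0 <= s <= 1 -> `|l - P.[x]| <= r%:R * r.+2%:R ^+ r * E -> `|y - P.[x]| <= E ->
   `|l + s * (y - l) - P.[x]| <= lag_const r * E.
  move=> hs hl hy.
  have -> : l + s * (y - l) - P.[x] = (1 - s) * (l - P.[x]) + s * (y - P.[x]) by ring.
  apply: le_trans (ler_normD _ _) _; rewrite !normrM (@ger0_norm _ s); last lra.
  rewrite (@ger0_norm _ (1 - s)); last lra.
  rewrite /lag_const [leRHS]mulrDl mul1r; apply: lerD.
    by apply: le_trans hl; rewrite ler_piMl //; lra.
  by apply: le_trans hy; rewrite ler_piMl //; lra.
have lagc l : `|l - P.[x]| <= r%:R * r.+2%:R ^+ r * E -> `|l - P.[x]| <= lag_const r * E.
  by move=> H; apply: le_trans H _; rewrite /lag_const mulrDl mul1r lerDl.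
have ij_ge i j : i != j -> 1 <= `|i%:R - j%:R| :> R.
  rewrite neq_ltn ler_normr => /orP[] h; apply/orP; [right|left].
    have : i%:R + 1 <= j%:R :> R by rewrite natr1 ler_nat.
    by lra.
  have : j%:R + 1 <= i%:R :> R by rewrite natr1 ler_nat.
  by lra.
have ratio i j (y u v : R) : i != j -> y = u / n%:R -> `|u| <= r.+2%:R -> v = (i%:R - j%:R) / n%:R \/ v = (j%:R - i%:R) / n%:R ->
    `|y / v| <= r.+2%:R /\ v != 0.
  move=> /ij_ge ij -> hu hv.
  have vE : `|v| = `|i%:R - j%:R| / n%:R.
    by case: hv => ->; rewrite normrM normfV (@ger0_norm _ n%:R) ?ler0n // distrC.
  have v0 : 0 < `|v| by rewrite vE divr_gt0 //; lra.
  split; last by rewrite -normr_gt0.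
  rewrite normrM normfV ler_pdivrMr // vE normrM normfV (@ger0_norm _ n%:R) ?ler0n //.
  rewrite mulrA ler_pM2r ?invr_gt0 //; nra.
have LL : x <= 2 / n%:R -> `|Lr f n r x - P.[x]| <= r%:R * r.+2%:R ^+ r * E.
  move=> x2; have {}x2 : n%:R * x <= 2 by rewrite -(ler_pM2l n0) sc in x2.
  have nx0 : 0 <= n%:R * x by rewrite mulr_ge0 //; lra.
  apply: (lagf (fun i => i%:R / n%:R)) => [i j|i] /andP[i1 i2]; last first.
    rewrite ltnS in i2; have i1' : 1 <= i%:R :> R by rewrite ler1n.
    have i2' : i%:R <= r%:R :> R by rewrite ler_nat.
    apply: HE.
      by apply/andP; split; rewrite -(ler_pM2l n0) ?mulrBr !sc; lra.
    by rewrite -(ler_pM2l n0) -{1}(gtr0_norm n0) -normrM mulrBr !sc ler_norml; lra.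
  move=> /andP[j1 j2] ij; rewrite -subr_eq0; apply: (@ratio i j _ (n%:R * x - j%:R)) => //.
  - by field.
  - have j1' : 1 <= j%:R :> R by rewrite ler1n.
    have j2' : j%:R <= r%:R :> R by rewrite ler_nat.
    by rewrite ler_norml; lra.
  - by left; rewrite mulrBl.
have RR : 1 - 2 / n%:R <= x -> `|Rr f n r x - P.[x]| <= r%:R * r.+2%:R ^+ r * E.
  move=> x2; have {}x2 : n%:R - 2 <= n%:R * x by rewrite -(ler_pM2l n0) mulrBr sc mulr1 in x2.
  have nx0 : n%:R * x <= n%:R by rewrite ler_piMr //; lra.
  apply: (lagf (fun i => 1 - i%:R / n%:R)) => [i j|i] /andP[i1 i2]; last first.
    rewrite ltnS in i2; have i1' : 1 <= i%:R :> R by rewrite ler1n.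
    have i2' : i%:R <= r%:R :> R by rewrite ler_nat.
    apply: HE.
      by apply/andP; split; rewrite -(ler_pM2l n0) ?mulrBr !sc; lra.
    by rewrite -(ler_pM2l n0) -{1}(gtr0_norm n0) -normrM !mulrBr !sc ler_norml; lra.
  move=> /andP[j1 j2] ij; rewrite -subr_eq0; apply: (@ratio i j _ (n%:R * x - n%:R + j%:R)) => //.
  - by field.
  - have j1' : 1 <= j%:R :> R by rewrite ler1n.
    have j2' : j%:R <= r%:R :> R by rewrite ler_nat.
    by rewrite ler_norml; lra.
  - by right; rewrite mulrBl; ring.
have xI : 1 / n%:R <= x -> x <= 1 - 1 / n%:R -> `|f x - P.[x]| <= E.
  move=> h1 h2; apply: HE; first by rewrite h1.
  by rewrite subrr normr0 divr_ge0 // ler0n.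
have s1 : n%:R * (1 / n%:R) = 1 :> R by exact: sc.
have s2 : n%:R * (2 / n%:R) = 2 :> R by exact: sc.
have inv2 : 2 / n%:R = 2 * (1 / n%:R) :> R by rewrite mulrA mulr1.
rewrite /Fn /=.
case: (leP x (1 / n%:R)) => h1; first by apply: lagc; apply: LL; lra.
case: (leP x (2 / n%:R)) => h2; first by apply: mix => //; [exact: LL|apply: xI; lra].
case: (ltP x (1 - 2 / n%:R)) => h3.
  apply: le_trans (xI _ _) _; [lra|lra|].
  by rewrite /lag_const mulrDl mul1r lerDr !mulr_ge0 // ?exprn_ge0 ?ler0n.
case: (ltP x (1 - 1 / n%:R)) => h4; first by apply: mix => //; [exact: RR|apply: xI; lra].
by apply: lagc; apply: RR; lra.
Qed.

End Lagrange.

Section Bernstein.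
Variable R : realType.
Implicit Types (c u v : nat -> R) (m r k n : nat) (x E : R) (P : {poly R}).

Definition bas m k : {poly R} := 'C(m, k)%:R *: ('X ^+ k * (1 - 'X) ^+ (m - k)).
Definition bernp m c : {poly R} := \sum_(k < m.+1) c k *: bas m k.
Definition dif c k : R := c k.+1 - c k.
Definition difn r c := iter r dif c.

Lemma bas_horner m k x : (bas m k).[x] = 'C(m, k)%:R * x ^+ k * (1 - x) ^+ (m - k).
Proof.
rewrite /bas hornerZ hornerM !horner_exp hornerD hornerN hornerX mulrA.
by congr (_ * (_ - _) ^+ _); exact: (hornerC 1 x).
Qed.

Lemma bas_ge0 m k x : 0 <= x <= 1 -> 0 <= (bas m k).[x].
Proof.
move=> hx; rewrite bas_horner; apply: mulr_ge0; last by rewrite exprn_ge0; lra.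
by rewrite mulr_ge0 ?ler0n // exprn_ge0; lra.
Qed.

Lemma deriv_1BX n : ((1 - 'X) ^+ n.+1)^`() = - n.+1%:R *: (1 - 'X) ^+ n :> {poly R}.
Proof.
rewrite deriv_exp derivB derivC derivX sub0r mulNr mul1r /= scaleNr.
by rewrite scaler_nat mulNrn.
Qed.

Lemma deriv_bas0 m : (bas m.+1 0)^`() = - (m.+1%:R *: bas m 0).
Proof. by rewrite /bas !bin0 !scale1r !expr0 !mul1r !subn0 deriv_1BX scaleNr. Qed.

Lemma deriv_basS m k : (k <= m)%N ->
  (bas m.+1 k.+1)^`() = m.+1%:R *: (bas m k - bas m k.+1).
Proof.
have dX : (('X : {poly R}) ^+ k.+1)^`() = k.+1%:R *: ('X ^+ k) by rewrite derivXn scaler_nat.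
move=> km; rewrite /bas derivZ derivM dX subSS scalerBr !scalerA.
have e1 : 'C(m.+1, k.+1)%:R * k.+1%:R = m.+1%:R * 'C(m, k)%:R :> R.
  by rewrite -!natrM mulnC -mul_bin_diag.
have [mk|mk] := leqP m k.
  have -> : m = k by apply/eqP; rewrite eqn_leq mk km.
  rewrite !subnn !binn bin_small // mulr0n mulr0 scale0r subr0 expr0 -(polyC1 R) derivC mulr0 addr0.
  by rewrite ?scale1r ?mulr1 ?mul1r ?mulr1 ?scalerA. 
have e2 : 'C(m.+1, k.+1)%:R * (m - k)%:R = m.+1%:R * 'C(m, k.+1)%:R :> R.
  by rewrite -!natrM (mul_bin_down m.+1 k.+1) subSS mulnC.
have -> : (m - k = (m - k.+1).+1)%N by rewrite -subSn.
rewrite deriv_1BX -subSn // subSS scalerDr -scalerAl scalerA e1.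
by congr (_ + _); rewrite -scalerAr scalerA mulrN e2 scaleNr.
Qed.

Lemma bas_small m : bas m m.+1 = 0.
Proof. by rewrite /bas bin_small // scale0r. Qed.

Lemma deriv_bernp m c : (bernp m.+1 c)^`() = m.+1%:R *: bernp m (dif c).
Proof.
have E : bernp m c = c 0%N *: bas m 0 + \sum_(k < m.+1) c k.+1 *: bas m k.+1.
  have <- : \sum_(k < m.+2) c k *: bas m k = c 0%N *: bas m 0 + \sum_(k < m.+1) c k.+1 *: bas m k.+1.
    by rewrite big_ord_recl; congr (_ + _); apply: eq_bigr => k _; rewrite lift0.
  by rewrite [RHS]big_ord_recr /= bas_small scaler0 addr0.
have -> : bernp m (dif c) = \sum_(k < m.+1) c k.+1 *: bas m k - bernp m c.
  by rewrite /bernp -sumrB; apply: eq_bigr => k _; rewrite /dif scalerBl.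
rewrite E /bernp big_ord_recl derivD derivZ deriv_bas0 raddf_sum /=.
rewrite opprD addrCA scalerDr; congr (_ + _).
  by rewrite !scalerN !scalerA (mulrC (c _)).
rewrite -sumrB scaler_sumr; apply: eq_bigr => k _.
rewrite (_ : bump 0 k = k.+1) // derivZ deriv_basS ?leq_ord // -scalerBr.
by rewrite [LHS]scalerA [RHS]scalerA mulrC.
Qed.

Lemma derivn_bernp m r c : (bernp (m + r) c)^`(r) = ((m + r) ^_ r)%:R *: bernp m (difn r c).
Proof.
elim: r c => [|r IH] c; first by rewrite derivn0 addn0 ffactn0 scale1r.
rewrite derivSn addnS deriv_bernp derivnZ IH scalerA -natrM -ffactSS; congr (_ *: bernp m _).
by rewrite /difn iterSr.
Qed.

Lemma difnS n u k : difn n.+1 u k = difn n u k.+1 - difn n u k.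
Proof. by []. Qed.

Lemma difnB n u v k : difn n (fun j => u j - v j) k = difn n u k - difn n v k.
Proof. by elim: n k => // n IH k; rewrite !difnS !IH; ring. Qed.

Lemma difnD n u v k : difn n (fun j => u j + v j) k = difn n u k + difn n v k.
Proof. by elim: n k => // n IH k; rewrite !difnS !IH; ring. Qed.

Lemma difnZ n (h : R) u k : difn n (fun j => h * u j) k = h * difn n u k.
Proof. by elim: n k => // n IH k; rewrite !difnS !IH; ring. Qed.

Lemma difnM n u k : difn n.+1 (fun j => j%:R * u j) k = k%:R * difn n.+1 u k + n.+1%:R * difn n u k.+1.
Proof.
elim: n k => [|n IH] k; first by rewrite /difn /= /dif -natr1; ring.
by rewrite difnS !IH !(difnS n.+1) (difnS n) -!natr1; ring.
Qed.

Lemma difn_const n (h : R) k : difn n.+1 (fun=> h) k = 0.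
Proof. by elim: n k => [|n IH] k; rewrite difnS ?IH ?subrr // /difn /= subrr. Qed.

Lemma difn_poly n P (h : R) k : (size P <= n)%N -> difn n (fun j => P.[j%:R * h]) k = 0.
Proof.
have difn0 i j : difn i (fun=> 0) j = 0.
  by case: i => // i; exact: difn_const.
elim: n P k => [|n IH] P k sP.
  by move: sP; rewrite size_poly_leq0 => /eqP ->; rewrite /difn /= horner0.
elim/poly_ind: P sP => [|P c _] sP.
  rewrite -[RHS](difn0 n.+1 k); congr difn; apply/funext => j; exact: horner0.
have sP' : (size P <= n)%N.
  have [->|P0] := eqVneq P 0; first by rewrite size_poly0.
  by move: sP; rewrite size_MXaddC (negPf P0).
have -> : (fun j => (P * 'X + c%:P).[j%:R * h]) =
   (fun j => (fun i => h * (fun l => l%:R * P.[l%:R * h]) i) j + (fun=> c) j).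
  by apply/funext => j; rewrite hornerMXaddC /=; ring.
rewrite difnD difn_const addr0 difnZ.
case: n IH sP sP' => [|n] IH sP sP'.
  rewrite (_ : (fun l => _) = fun=> 0) ?difn0 ?mulr0 //; apply/funext => l.
  by move: sP'; rewrite size_poly_leq0 => /eqP ->; rewrite horner0 mulr0.
by rewrite difnM difnS !IH // subrr !mulr0 addr0 mulr0.
Qed.

Lemma difn_bound n u E k : (forall j, (k <= j <= k + n)%N -> `|u j| <= E) ->
  `|difn n u k| <= 2 ^+ n * E.
Proof.
elim: n k => [|n IH] k H; first by rewrite expr0 mul1r; apply: H; rewrite leqnn leq_addr.
rewrite difnS; apply: le_trans (ler_normB _ _) _.
have h1 : `|difn n u k.+1| <= 2 ^+ n * E by apply: IH => j hj; apply: H; lia.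
have h2 : `|difn n u k| <= 2 ^+ n * E by apply: IH => j hj; apply: H; lia.
by rewrite exprS -mulrA; lra.
Qed.

Lemma BernE m (g : R -> R) : Bern m g = horner (bernp m (fun k => g (k%:R / m%:R))).
Proof.
apply/funext => x; rewrite /Bern /bernp horner_sum big_mkord; apply: eq_bigr => k _.
by rewrite hornerZ bas_horner !mulrA.
Qed.

Lemma derive1n_horner P r : derive1n r (horner P) = horner P^`(r).
Proof. by elim: r => [|r IH] //; rewrite derive1nS IH -derivE derivnS. Qed.

End Bernstein.

Section Moments.
Variable R : realType.
Implicit Types (a b x t : R) (m k n N : nat).

Lemma sum_bas_gen m (p q : R) : \sum_(k < m.+1) 'C(m, k)%:R * p ^+ k * q ^+ (m - k) = (p + q) ^+ m.
Proof.
rewrite addrC exprDn; apply: eq_bigr => k _.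
by rewrite -[RHS]mulr_natl -!mulrA; congr (_ * _); rewrite mulrC.
Qed.

Lemma sum_bas m x : \sum_(k < m.+1) (bas R m k).[x] = 1.
Proof.
under eq_bigr => k _ do rewrite bas_horner.
by rewrite sum_bas_gen addrC subrK expr1n.
Qed.

Lemma basSS m k x : (bas R m.+1 k.+1).[x] = m.+1%:R * x / k.+1%:R * (bas R m k).[x].
Proof.
have k0 : k.+1%:R != 0 :> R by rewrite pnatr_eq0.
have e1 : 'C(m.+1, k.+1)%:R = m.+1%:R * 'C(m, k)%:R / k.+1%:R :> R.
  by rewrite -natrM mul_bin_diag natrM mulrC mulKf.
by rewrite !bas_horner subSS exprS e1; field.
Qed.

Lemma bas_pow N m k x : 0 <= x <= 1 ->
  (bas R m k).[x] * (x * m.+1%:R / k.+1%:R) ^+ N <= N`!%:R * (bas R (m + N) (k + N)).[x].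
Proof.
move=> hx; elim: N => [|N IH]; first by rewrite !addn0 expr0 mulr1 mul1r.
set A := x * _ / _.
have A0 : 0 <= A by rewrite divr_ge0 ?mulr_ge0 ?ler0n //; lra.
have p0 : 0 <= (bas R (m + N) (k + N)).[x] by exact: bas_ge0.
rewrite exprSr mulrA; apply: (@le_trans _ _ (N`!%:R * (bas R (m + N) (k + N)).[x] * A)).
  exact: ler_wpM2r.
rewrite !addnS basSS factS natrM.
have -> : N.+1%:R * N`!%:R * ((m + N).+1%:R * x / (k + N).+1%:R * (bas R (m + N) (k + N)).[x])
   = N`!%:R * (bas R (m + N) (k + N)).[x] * (N.+1%:R * ((m + N).+1%:R * x / (k + N).+1%:R)) by ring.
rewrite ler_wpM2l ?mulr_ge0 ?ler0n // /A.
have k1 : 0 < k.+1%:R :> R by rewrite ltr0n.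
have k2 : 0 < (k + N).+1%:R :> R by rewrite ltr0n.
rewrite [leRHS]mulrA ler_pdivrMr // mulrAC ler_pdivlMr //.
have : (m.+1 * (k + N).+1 <= N.+1 * (m + N).+1 * k.+1)%N by nia.
rewrite -(ler_nat R) !natrM => H.
have x0 : 0 <= x by lra.
have := ler_wpM2l x0 H; rewrite !mulrA; lra.
Qed.

Lemma sum_pow N m x : 0 <= x <= 1 ->
  \sum_(k < m.+1) (bas R m k).[x] * (x * m.+1%:R / k.+1%:R) ^+ N <= N`!%:R.
Proof.
move=> hx; apply: (@le_trans _ _ (\sum_(k < m.+1) N`!%:R * (bas R (m + N) (k + N)).[x])).
  by apply: ler_sum => k _; exact: bas_pow.
rewrite -mulr_sumr ler_piMr ?ler0n // -(sum_bas (m + N) x).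
rewrite -(big_mkord xpredT (fun k => (bas R (m + N) (k + N)).[x])).
rewrite -(big_mkord xpredT (fun k => (bas R (m + N) k).[x])).
rewrite (@big_cat_nat _ _ _ N 0 (m + N).+1) //=; last lia.
have -> F : \sum_(N <= k < (m + N).+1) F k = \sum_(0 <= k < m.+1) F (k + N)%N :> R.
  by rewrite -[X in bigop _ (index_iota X _)]add0n big_addn -addSn addnK.
by rewrite lerDr sumr_ge0 // => k _; exact: bas_ge0.
Qed.

Lemma bas_sym m k x : (k <= m)%N -> (bas R m k).[x] = (bas R m (m - k)).[1 - x].
Proof.
move=> km; rewrite !bas_horner bin_sub // subKn // (_ : 1 - (1 - x) = x); last by ring.
by rewrite -!mulrA; congr (_ * _); rewrite mulrC.
Qed.

Lemma sum_pow_sym N m x : 0 <= x <= 1 ->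
  \sum_(k < m.+1) (bas R m k).[x] * ((1 - x) * m.+1%:R / (m - k).+1%:R) ^+ N <= N`!%:R.
Proof.
move=> hx; have hx' : 0 <= 1 - x <= 1 by lra.
rewrite -(big_mkord xpredT (fun k => (bas R m k).[x] * ((1 - x) * m.+1%:R / (m - k).+1%:R) ^+ N)).
rewrite big_nat_rev /= add0n.
apply: le_trans (sum_pow N m hx'); rewrite big_mkord; apply: ler_sum => k _.
have km : (k <= m)%N by rewrite -ltnS.
by rewrite subSS bas_sym ?leq_subr // subKn.
Qed.

Lemma powR_le_1X (A a : R) N : 0 <= A -> 0 <= a <= N%:R -> A `^ a <= 1 + A ^+ N.
Proof.
move=> A0 /andP[a0 aN]; have [A1|A1] := leP A 1.
  apply: (@le_trans _ _ 1); last by rewrite lerDl exprn_ge0.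
  have -> : 1 = 1 `^ a :> R by rewrite powR1.
  by rewrite ge0_ler_powR // ?nnegrE.
apply: (@le_trans _ _ (A ^+ N)); last by rewrite lerDr.
by rewrite -powR_mulrn // ler_powR // ltW.
Qed.

Lemma sum_weight a b : 0 <= a -> 0 <= b -> exists2 C : R, 0 < C & forall m x, 0 <= x <= 1 ->
  \sum_(k < m.+1) (bas R m k).[x] *
     ((x * m.+1%:R / k.+1%:R) `^ a * ((1 - x) * m.+1%:R / (m - k).+1%:R) `^ b) <= C.
Proof.
move=> a0 b0.
have [N aN] : exists N : nat, a <= N%:R by exists (Num.bound a); exact/ltW/archi_boundP.
have [M bM] : exists N : nat, b <= N%:R by exists (Num.bound b); exact/ltW/archi_boundP.
exists (4 + 2 * (N * 2)`!%:R + 2 * (M * 2)`!%:R).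
  by have := ler0n R (N * 2)`!; have := ler0n R (M * 2)`!; lra.
move=> m x hx.
have H1 := sum_pow (N * 2) m hx; have H2 := sum_pow_sym (M * 2) m hx.
apply: (@le_trans _ _ (\sum_(k < m.+1) (4 * (bas R m k).[x]
   + 2 * ((bas R m k).[x] * (x * m.+1%:R / k.+1%:R) ^+ (N * 2))
   + 2 * ((bas R m k).[x] * ((1 - x) * m.+1%:R / (m - k).+1%:R) ^+ (M * 2))))); last first.
  by rewrite !big_split /= -!mulr_sumr sum_bas; lra.
apply: ler_sum => k _.
have p0 := bas_ge0 m k hx.
set A := x * _ / _; set B := (1 - x) * _ / _.
have A0 : 0 <= A by rewrite divr_ge0 ?mulr_ge0 ?ler0n //; lra.
have B0 : 0 <= B by rewrite divr_ge0 ?mulr_ge0 ?ler0n //; lra.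
have hA := @powR_le_1X A a N A0 ltac:(lra); have hB := @powR_le_1X B b M B0 ltac:(lra).
have -> : forall p u v : R, 4 * p + 2 * (p * u) + 2 * (p * v) = p * (4 + 2 * u + 2 * v).
  by move=> *; ring.
rewrite ler_wpM2l // !exprM.
apply: le_trans (ler_pM (powR_ge0 _ _) (powR_ge0 _ _) hA hB) _.
move: (A ^+ N) (B ^+ M) => u v.
have := sqr_ge0 (u - v); have := sqr_ge0 (u - 1); have := sqr_ge0 (v - 1).
by have := sqr_ge0 u; have := sqr_ge0 v; lra.
Qed.

Lemma expR_quad (s : R) : s <= 1 / 2 -> expR s <= 1 + s + 2 * s ^+ 2.
Proof.
move=> hs; have h := expR_ge1Dx (- s).
have e : expR s * expR (- s) = 1 by rewrite -expRD subrr expR0.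
have h0 : 0 < 1 - s by lra.
have : expR s * (1 - s) <= 1 by rewrite -[leRHS]e ler_pM2l ?expR_gt0.
rewrite -ler_pdivlMr // => H; apply: le_trans H _.
rewrite ler_pdivrMr //.
have s2 : 0 <= 1 - 2 * s by lra.
by have := mulr_ge0 (sqr_ge0 s) s2; lra.
Qed.

Lemma exp_moment m x t : 0 <= x <= 1 -> `|t| <= 1 / 2 ->
  \sum_(k < m.+1) (bas R m k).[x] * expR (t * (k%:R - m%:R * x)) <= expR (2 * (m%:R * (x * (1 - x))) * t ^+ 2).
Proof.
move=> hx; rewrite ler_norml => ht.
have -> : \sum_(k < m.+1) (bas R m k).[x] * expR (t * (k%:R - m%:R * x)) =
   (x * expR (t * (1 - x)) + (1 - x) * expR (- (t * x))) ^+ m.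
  rewrite -sum_bas_gen; apply: eq_bigr => k _; rewrite bas_horner !exprMn -!expRM_natl.
  have km : (k <= m)%N by rewrite -ltnS.
  rewrite -!mulrA; congr (_ * (_ * _)); rewrite mulrCA; congr (_ * _).
  by rewrite -expRD natrB //; congr expR; ring.
have -> : expR (2 * (m%:R * (x * (1 - x))) * t ^+ 2) = expR (2 * (x * (1 - x)) * t ^+ 2) ^+ m.
  by rewrite -expRM_natl; congr expR; ring.
rewrite lerXn2r ?nnegrE ?expR_ge0 //.
  by rewrite addr_ge0 // mulr_ge0 ?expR_ge0 //; lra.
apply: le_trans (expR_ge1Dx _).
have h1 : expR (t * (1 - x)) <= 1 + t * (1 - x) + 2 * (t * (1 - x)) ^+ 2 by apply: expR_quad; nra.
have h2 : expR (- (t * x)) <= 1 + - (t * x) + 2 * (- (t * x)) ^+ 2 by apply: expR_quad; nra.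
have x0 : 0 <= x by lra. have x1 : 0 <= 1 - x by lra.
apply: le_trans (lerD (ler_wpM2l x0 h1) (ler_wpM2l x1 h2)) _.
by rewrite le_eqVlt; apply/orP; left; apply/eqP; ring.
Qed.

Lemma pow_le_exp n (y : R) : 0 <= y -> y ^+ n <= n%:R ^+ n * expR y.
Proof.
case: n => [|n] y0; first by rewrite !expr0 mul1r; apply: le_trans (expR_ge1Dx _); rewrite lerDl.
have n0 : 0 < n.+1%:R :> R by rewrite ltr0n.
have -> : expR y = expR (y / n.+1%:R) ^+ n.+1.
  by rewrite -expRM_natl mulrCA divff ?mulr1 // gt_eqF.
rewrite -exprMn; apply: lerXn2r; rewrite ?nnegrE ?mulr_ge0 ?expR_ge0 ?ler0n //.
rewrite -ler_pdivrMl // mulrC; apply: le_trans (expR_ge1Dx _); by rewrite lerDr.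
Qed.

Lemma abs_moment n m x (s : R) : 0 <= x <= 1 -> s ^+ 2 = m%:R * (x * (1 - x)) -> 1 <= s ->
  \sum_(k < m.+1) (bas R m k).[x] * (`|k%:R - m%:R * x| / s) ^+ n <= (2 * n%:R) ^+ n * (2 * expR 1).
Proof.
move=> hx s2 s1; have s0 : 0 < s by lra.
pose E t := \sum_(k < m.+1) (bas R m k).[x] * expR (t * (k%:R - m%:R * x)).
pose t0 := (2 * s)^-1.
have t0E : t0 * s = 1 / 2 by rewrite /t0; field; lra.
have t00 : 0 < t0 by rewrite invr_gt0; lra.
have tle : t0 <= 1 / 2 by rewrite -t0E ler_peMr // ltW.
have HE t : `|t| = t0 -> E t <= expR 1.
  move=> tt; apply: le_trans (exp_moment m hx _) _; first by rewrite tt.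
  rewrite ler_expR -s2 -(real_normK (num_real t)) tt.
  have -> : 2 * s ^+ 2 * t0 ^+ 2 = 2 * (t0 * s) ^+ 2 by ring.
  by rewrite t0E; lra.
have H1 : E t0 <= expR 1 by apply: HE; rewrite gtr0_norm.
have H2 : E (- t0) <= expR 1 by apply: HE; rewrite normrN gtr0_norm.
apply: (@le_trans _ _ ((2 * n%:R) ^+ n * (E t0 + E (- t0)))); last first.
  by rewrite ler_wpM2l ?exprn_ge0 ?mulr_ge0 ?ler0n //; lra.
rewrite /E -big_split /= mulr_sumr; apply: ler_sum => k _.
rewrite -mulrDr mulrCA ler_wpM2l ?bas_ge0 //.
set u := k%:R - _.
have -> : `|u| / s = 2 * (t0 * `|u|) by rewrite /t0; field; lra.
rewrite !exprMn -mulrA ler_wpM2l ?exprn_ge0 //.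
have y0 : 0 <= t0 * `|u| by rewrite mulr_ge0 // ltW.
rewrite -exprMn; apply: le_trans (pow_le_exp n y0) _.
rewrite ler_wpM2l ?exprn_ge0 ?ler0n //.
case: (ger0P u) => _; first by rewrite lerDl expR_ge0.
by rewrite mulrN -mulNr lerDr expR_ge0.
Qed.

End Moments.

Section DerivativeBounds.
Variable R : realType.
Implicit Types (a b x D E : R) (c : nat -> R) (m k r : nat).

Definition node_wgt a b m k : R := (m.+1%:R / k.+1%:R) `^ a * (m.+1%:R / (m - k).+1%:R) `^ b.

Lemma wgt_node_wgt a b m k x : 0 <= x <= 1 -> wgt a b x * node_wgt a b m k =
  (x * m.+1%:R / k.+1%:R) `^ a * ((1 - x) * m.+1%:R / (m - k).+1%:R) `^ b.
Proof.
move=> hx; rewrite /wgt /node_wgt -!mulrA !powRM ?divr_ge0 ?ler0n //; [|lra|lra].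
ring.
Qed.

Lemma wgt_ge0 a b x : 0 <= wgt a b x.
Proof. by rewrite mulr_ge0 ?powR_ge0. Qed.

Lemma derivn_bernp_end a b r : 0 <= a -> 0 <= b -> exists2 C : R, 0 < C & forall m c D x,
  0 <= x <= 1 -> 0 <= D -> (forall k, (k <= m)%N -> `|difn r c k| <= D * node_wgt a b m k) ->
  wgt a b x * `|(bernp (m + r) c)^`(r).[x]| <= C * D * (m + r)%:R ^+ r.
Proof.
move=> a0 b0; have [C C0 HC] := sum_weight a0 b0; exists C => // m c D x hx D0 H.
rewrite derivn_bernp hornerZ normrM (@ger0_norm _ _%:R) ?ler0n // mulrCA mulrC.
have w0 := wgt_ge0 a b x.
apply: ler_pM; [by rewrite mulr_ge0|exact: ler0n| |]; last first.
  by rewrite -natrX ler_nat ffact_prod -[r in (_ ^ r)%N]card_ord -prod_nat_const; apply: leq_prod => i _; rewrite leq_subr.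
apply: (@le_trans _ _ (wgt a b x * \sum_(k < m.+1) `|(difn r c k *: bas R m k).[x]|)).
  by rewrite ler_wpM2l ?wgt_ge0 // /bernp horner_sum ler_norm_sum.
apply: (@le_trans _ _ (D * \sum_(k < m.+1) (bas R m k).[x] *
     ((x * m.+1%:R / k.+1%:R) `^ a * ((1 - x) * m.+1%:R / (m - k).+1%:R) `^ b))); last first.
  by rewrite [leRHS]mulrC ler_wpM2l // HC.
rewrite !mulr_sumr; apply: ler_sum => k _.
rewrite -wgt_node_wgt // hornerZ normrM (ger0_norm (bas_ge0 _ _ hx)).
have := ler_wpM2r (mulr_ge0 (bas_ge0 m k hx) (wgt_ge0 a b x)) (H k (leq_ord k)).
by lra.
Qed.

Definition Xp : {poly R} := 'X * (1 - 'X).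
Definition yp : {poly R} := 1 - 'X *+ 2.
Definition cpoly m k : {poly R} := k%:R%:P - m%:R%:P * 'X.

Lemma bas_ode m k : (k <= m)%N -> Xp * (bas R m k)^`() = cpoly m k * bas R m k.
Proof.
move=> km; rewrite /bas derivZ -!scalerAr; congr (_ *: _).
rewrite derivM mulrDr.
have e1 : Xp * (('X : {poly R}) ^+ k)^`() = k%:R%:P * (1 - 'X) * 'X ^+ k.
  case: k {km} => [|k]; first by rewrite expr0 -(polyC1 R) derivC mulr0 polyC0 !mul0r.
  by rewrite derivXn /Xp exprS -mulr_natl polyC_natr /=; ring.
have e2 : Xp * ((1 - 'X : {poly R}) ^+ (m - k))^`() = - (m - k)%:R%:P * 'X * (1 - 'X) ^+ (m - k).
  case: (m - k)%N => [|j]; first by rewrite expr0 -(polyC1 R) derivC mulr0 polyC0 oppr0 !mul0r.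
  by rewrite deriv_1BX /Xp exprS -mul_polyC polyCN polyC_natr; ring.
rewrite mulrA e1 (mulrCA Xp) e2 /cpoly natrB // polyCB; ring.
Qed.

(* Families of polynomials [q m k] that occur as the cofactor in
   (X (1 - X))^r p^(r) = q p for p = bas m k; the two side conditions on the
   exponents are what bounds q by a multiple of (m X (1 - X))^(r/2). *)
Inductive cofactor (r : nat) : (nat -> nat -> {poly R}) -> Prop :=
| cofactor_term (l : R) (i j e d : nat) : (i + 2 * j <= r)%N -> (j <= e)%N ->
    cofactor r (fun m k => l%:P * (cpoly m k ^+ i * m%:R%:P ^+ j * Xp ^+ e * yp ^+ d))
| cofactor_add q1 q2 : cofactor r q1 -> cofactor r q2 ->
    cofactor r (fun m k => q1 m k + q2 m k).

Lemma cofactor_eq r q q' : (forall m k, q m k = q' m k) -> cofactor r q -> cofactor r q'.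
Proof. by move=> H; have -> : q' = q by apply/funext => m; apply/funext => k. Qed.

Lemma cofactor_cpoly r q : cofactor r q -> cofactor r.+1 (fun m k => cpoly m k * q m k).
Proof.
elim=> [l i j e d h1 h2|q1 q2 _ h1 _ h2].
  apply: cofactor_eq (@cofactor_term r.+1 l i.+1 j e d _ h2); last lia.
  by move=> m k; rewrite exprS; ring.
by apply: cofactor_eq (cofactor_add h1 h2) => m k; rewrite -mulrDr.
Qed.

Lemma cofactor_yp r (l : R) q : cofactor r q -> cofactor r.+1 (fun m k => l%:P * yp * q m k).
Proof.
elim=> [l' i j e d h1 h2|q1 q2 _ h1 _ h2].
  apply: cofactor_eq (@cofactor_term r.+1 (l * l') i j e d.+1 _ h2); last lia.
  by move=> m k; rewrite exprS polyCM; ring.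
by apply: cofactor_eq (cofactor_add h1 h2) => m k; rewrite -mulrDr.
Qed.

Lemma deriv_cpoly m k : (cpoly m k)^`() = - m%:R%:P.
Proof. rewrite /cpoly derivB derivC derivM derivC derivX; ring. Qed.

Lemma deriv_Xp : Xp^`() = yp.
Proof. rewrite /Xp /yp derivM derivB derivX -(polyC1 R) derivC; ring. Qed.

Lemma deriv_yp : yp^`() = - 2%:R%:P.
Proof. by rewrite /yp derivB derivMn derivX -(polyC1 R) derivC sub0r polyC_natr. Qed.

Lemma cofactor_deriv r q : cofactor r q -> cofactor r.+1 (fun m k => Xp * (q m k)^`()).
Proof.
elim=> [l i j e d h1 h2|q1 q2 _ h1 _ h2]; last first.
  by apply: cofactor_eq (cofactor_add h1 h2) => m k; rewrite derivD mulrDr.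
pose t1 m k := (- (i%:R * l))%:P * (cpoly m k ^+ i.-1 * m%:R%:P ^+ j.+1 * Xp ^+ e.+1 * yp ^+ d).
have c1 : cofactor r.+1 t1.
  case: i h1 @t1 => [|i] h1 t1; last by apply: cofactor_term; lia.
  apply: cofactor_eq (@cofactor_term r.+1 0 0 0 0 0 _ _) => //.
  by move=> m k; rewrite /t1 mulr0n (mul0r l) oppr0 polyC0 !(mul0r (_ * _)).
have c2 : cofactor r.+1 (fun m k => (e%:R * l)%:P * (cpoly m k ^+ i * m%:R%:P ^+ j * Xp ^+ e * yp ^+ d.+1)).
  by apply: cofactor_term; lia.
have c3 : cofactor r.+1 (fun m k => (- (2 * d%:R * l))%:P * (cpoly m k ^+ i * m%:R%:P ^+ j * Xp ^+ e.+1 * yp ^+ d.-1)).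
  by apply: cofactor_term; lia.
apply: cofactor_eq (cofactor_add c1 (cofactor_add c2 c3)) => m k.
have dm : ((m%:R%:P : {poly R}) ^+ j)^`() = 0 by rewrite -polyC_exp derivC.
have dU : (cpoly m k ^+ i)^`() = i%:R * (- m%:R%:P * cpoly m k ^+ i.-1).
  by rewrite deriv_exp deriv_cpoly mulr_natl.
have dE : Xp * (Xp ^+ e)^`() = e%:R * (yp * Xp ^+ e).
  rewrite deriv_exp deriv_Xp; case: (e) => [|e1]; first by rewrite mulr0n mulr0 mul0r.
  by rewrite -mulr_natl exprS /=; ring.
have dY : (yp ^+ d)^`() = d%:R * (- 2%:R%:P * yp ^+ d.-1).
  by rewrite deriv_exp deriv_yp mulr_natl.
rewrite /t1 derivM derivC mul0r add0r !derivM dm mulr0 addr0 dU dY.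
rewrite !polyCN !polyCM !polyC_natr (exprS _ j) (exprS Xp e) (exprS yp d).
move: (cpoly m k ^+ i) (cpoly m k ^+ i.-1) (yp ^+ d) (yp ^+ d.-1) => U U' Y Y'.
transitivity (l%:P * (Xp * (i%:R * (- m%:R * U')) * m%:R ^+ j * Xp ^+ e * Y + U * m%:R ^+ j * (Xp * (Xp ^+ e)^`()) * Y
   + U * m%:R ^+ j * Xp ^+ e * (Xp * (d%:R * (- 2%:R * Y'))))); first by rewrite dE; ring.
by move: (Xp ^+ e)^`() => V; ring.
Qed.

Lemma cofactor_deriv_bas r : exists2 q, cofactor r q & forall m k, (k <= m)%N ->
  Xp ^+ r * (bas R m k)^`(r) = q m k * bas R m k.
Proof.
elim: r => [|r [q cq Hq]].
  exists (fun m k => 1%:P * (cpoly m k ^+ 0 * m%:R%:P ^+ 0 * Xp ^+ 0 * yp ^+ 0)).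
    exact: cofactor_term.
  by move=> m k _; rewrite !expr0 derivn0 polyC1 !mul1r.
exists (fun m k => Xp * (q m k)^`() + (cpoly m k * q m k + (- r%:R)%:P * yp * q m k)).
  apply: cofactor_add; first exact: cofactor_deriv.
  by apply: cofactor_add; [exact: cofactor_cpoly|exact: cofactor_yp].
move=> m k km; have H := congr1 (fun p => Xp * p^`()) (Hq m k km).
move: H; rewrite /= !derivM deriv_exp deriv_Xp -derivnS mulrDr mulrDr (mulrCA Xp (q m k)) bas_ode //.
move=> H.
have E : Xp * (yp * Xp ^+ r.-1 *+ r * (bas R m k)^`(r)) = r%:R * yp * (Xp ^+ r * (bas R m k)^`(r)).
  case: (r) => [|r1]; first by rewrite mulr0n !mul0r mulr0.
  by rewrite -mulr_natl exprS /=; ring.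
move: H; rewrite E Hq // => H.
rewrite exprS -mulrA; apply: (addrI (r%:R * yp * (q m k * bas R m k))).
rewrite H polyCN polyC_natr; ring.
Qed.

Lemma cofactor_bound r q : cofactor r q -> exists2 C : R, 0 <= C & forall m k x s,
  0 < x < 1 -> s ^+ 2 = m%:R * (x * (1 - x)) -> 1 <= s ->
  `|(q m k).[x]| <= C * s ^+ r * (1 + (`|k%:R - m%:R * x| / s) ^+ r).
Proof.
elim=> [l i j e d h1 h2|q1 q2 _ [C1 C10 H1] _ [C2 C20 H2]]; last first.
  exists (C1 + C2); first exact: addr_ge0.
  move=> m k x s hx s2 s1; rewrite hornerD; apply: le_trans (ler_normD _ _) _.
  by rewrite !mulrDl lerD // ?H1 ?H2.
exists `|l| => // m k x s hx s2 s1.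
have s0 : 0 < s by lra.
have Xx : 0 < x * (1 - x) by rewrite mulr_gt0; lra.
have X1 : x * (1 - x) <= 1 by have := sqr_ge0 (x - 1 / 2); lra.
have uE : (cpoly m k).[x] = k%:R - m%:R * x by rewrite /cpoly hornerD hornerN hornerM !hornerC hornerX.
have XE : Xp.[x] = x * (1 - x) by rewrite /Xp hornerM hornerD hornerN hornerX -(polyC1 R) hornerC.
have yE : yp.[x] = 1 - x *+ 2 by rewrite /yp hornerD hornerN hornerMn hornerX -(polyC1 R) hornerC.
rewrite !hornerM hornerC !horner_exp uE XE yE hornerC !normrM -[leRHS]mulrA ler_wpM2l //.
set u := `|k%:R - _|.
rewrite !normrX -/u (ger0_norm (ler0n _ m)) (gtr0_norm Xx).
have u0 : 0 <= u by exact: normr_ge0.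
have v0 : 0 <= u / s by rewrite divr_ge0 // ltW.
have y1 : `|1 - x *+ 2| ^+ d <= 1.
  by apply: exprn_ile1 => //; rewrite ler_norml mulr2n; lra.
have Xe : (x * (1 - x)) ^+ e <= (x * (1 - x)) ^+ j by rewrite ler_wiXn2l // ltW.
apply: (@le_trans _ _ (u ^+ i * m%:R ^+ j * (x * (1 - x)) ^+ j * 1)).
  have um : 0 <= u ^+ i * m%:R ^+ j by rewrite mulr_ge0 ?exprn_ge0 ?ler0n.
  have Xe0 : 0 <= (x * (1 - x)) ^+ e by rewrite exprn_ge0 // ltW.
  apply: ler_pM => //; first by rewrite mulr_ge0.
  by rewrite ler_wpM2l ?mulr_ge0 ?exprn_ge0 ?ler0n. 
rewrite mulr1 -mulrA -exprMn -s2.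
have -> : u ^+ i = s ^+ i * (u / s) ^+ i by rewrite -exprMn mulrCA divff ?mulr1 // gt_eqF.
rewrite -exprM mulrAC -exprD.
apply: ler_pM; [exact: exprn_ge0 (ltW s0)|exact: exprn_ge0 v0|exact: ler_weXn2l|].
have [v1|v1] := leP (u / s) 1.
  by apply: (@le_trans _ _ 1); [exact: exprn_ile1|rewrite lerDl exprn_ge0].
apply: (@le_trans _ _ ((u / s) ^+ r)); last by rewrite lerDr.
by rewrite ler_weXn2l ?(ltW v1) //; lia.
Qed.

Lemma derivn_bernp_mid a b r : 0 <= a -> 0 <= b -> exists2 C : R, 0 < C & forall m c E x s,
  0 < x < 1 -> 0 <= E -> s ^+ 2 = m%:R * (x * (1 - x)) -> 1 <= s ->
  (forall k, (k <= m)%N -> `|c k| <= E * node_wgt a b m k) ->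
  wgt a b x * ((x * (1 - x)) ^+ r * `|(bernp m c)^`(r).[x]|) <= C * E * s ^+ r.
Proof.
move=> a0 b0.
have [q cq Hq] := cofactor_deriv_bas r; have [C1 C10 H1] := cofactor_bound cq.
have [C2 C20 H2] := @sum_weight R (a * 2) (b * 2) ltac:(lra) ltac:(lra).
pose C3 := (2 * (r * 2)%:R) ^+ (r * 2) * (2 * expR 1) : R.
have C30 : 0 <= C3 by rewrite !mulr_ge0 ?exprn_ge0 ?mulr_ge0 ?ler0n ?expR_ge0.
exists ((C1 + 1) * (C2 + 2 + 2 * C3)); first by rewrite mulr_gt0 //; lra.
move=> m c E x s hx E0 s2 s1 Hc.
have hx' : 0 <= x <= 1 by lra.
have s0 : 0 < s by lra.
have Xx : 0 < x * (1 - x) by rewrite mulr_gt0; lra.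
have XE : Xp.[x] = x * (1 - x) by rewrite /Xp hornerM hornerD hornerN hornerX -(polyC1 R) hornerC.
pose v k := `|k%:R - m%:R * x| / s.
pose W k := wgt a b x * node_wgt a b m k.
have v0 k : 0 <= v k by rewrite divr_ge0 // ltW.
have -> : (x * (1 - x)) ^+ r * `|(bernp m c)^`(r).[x]| = `|\sum_(k < m.+1) c k * ((q m k).[x] * (bas R m k).[x])|.
  have Xr : 0 <= (x * (1 - x)) ^+ r by rewrite exprn_ge0 // ltW.
  rewrite -{1}(ger0_norm Xr) -normrM.
  rewrite -XE -horner_exp -hornerM /bernp linear_sum mulr_sumr horner_sum; congr `|_|.
  apply: eq_bigr => k _ /=; rewrite derivnZ -scalerAr hornerZ; congr (_ * _).
  by rewrite Hq ?leq_ord // hornerM.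
apply: (@le_trans _ _ (wgt a b x * \sum_(k < m.+1) `|c k * ((q m k).[x] * (bas R m k).[x])|)).
  by rewrite ler_wpM2l ?wgt_ge0 // ler_norm_sum.
apply: (@le_trans _ _ (\sum_(k < m.+1) E * C1 * s ^+ r * ((bas R m k).[x] * (W k * (1 + v k ^+ r))))).
  rewrite mulr_sumr; apply: ler_sum => k _.
  have p0 := bas_ge0 m k hx'.
  rewrite !normrM (ger0_norm p0) /W.
  have h1 := Hc k (leq_ord k); have h2 := H1 m k x s hx s2 s1.
  have := ler_pM (normr_ge0 _) (normr_ge0 _) h1 h2.
  move/(ler_wpM2l (mulr_ge0 p0 (wgt_ge0 a b x))) => h3.
  by rewrite /v; lra.
rewrite -mulr_sumr.
set S := \sum_(k < m.+1) _.
have SC : S <= C2 + 2 + 2 * C3.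
  apply: (@le_trans _ _ (\sum_(k < m.+1) ((bas R m k).[x] *
     ((x * m.+1%:R / k.+1%:R) `^ (a * 2) * ((1 - x) * m.+1%:R / (m - k).+1%:R) `^ (b * 2))
     + 2 * (bas R m k).[x] + 2 * ((bas R m k).[x] * v k ^+ (r * 2))))).
    apply: ler_sum => k _; have p0 := bas_ge0 m k hx'.
    have sq (A e : R) : A `^ (e * 2) = (A `^ e) ^+ 2 by rewrite powRrM powR_mulrn // powR_ge0.
    rewrite !sq -exprMn -wgt_node_wgt // -/(W k) exprM.
    move: (W k) (v k ^+ r) => y z.
    have -> : forall p : R, p * y ^+ 2 + 2 * p + 2 * (p * z ^+ 2) = p * (y ^+ 2 + 2 + 2 * z ^+ 2) by move=> p; ring.
    rewrite ler_wpM2l //.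
    have := sqr_ge0 (y - (1 + z)); have := sqr_ge0 (z - 1); have := sqr_ge0 y; have := sqr_ge0 (1 + z); lra.
  rewrite !big_split /= -!mulr_sumr sum_bas mulr1.
  by apply: lerD; [apply: lerD => //; exact: H2|rewrite ler_pM2l //; exact: abs_moment].
have S0 : 0 <= S.
  by apply: sumr_ge0 => k _; rewrite !mulr_ge0 ?bas_ge0 ?wgt_ge0 ?powR_ge0 // addr_ge0 // exprn_ge0.
have sr : 0 <= s ^+ r by rewrite exprn_ge0 // ltW.
apply: (@le_trans _ _ (E * (C1 + 1) * s ^+ r * S)).
  by rewrite ler_wpM2r // ler_wpM2r // ler_wpM2l //; lra.
have -> : (C1 + 1) * (C2 + 2 + 2 * C3) * E * s ^+ r = E * (C1 + 1) * s ^+ r * (C2 + 2 + 2 * C3) by ring.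
by rewrite ler_wpM2l // !mulr_ge0 //; lra.
Qed.

End DerivativeBounds.

Section Weights.
Variable R : realType.
Implicit Types (a b al be x t lam : R) (f : R -> R) (m k r n q M : nat).

Lemma phi_gt0 x : 0 < x < 1 -> 0 < phi x.
Proof. by move=> hx; rewrite /phi sqrtr_gt0 mulr_gt0; lra. Qed.

Lemma phi_sqr x : 0 < x < 1 -> phi x ^+ 2 = x * (1 - x).
Proof. by move=> hx; rewrite /phi sqr_sqrtr // ltW // mulr_gt0; lra. Qed.

Lemma wgt_phi al be p x : 0 < x < 1 ->
  wgt al be x * phi x `^ p = wgt (al + p / 2) (be + p / 2) x.
Proof.
move=> hx; have x0 : 0 < x by lra. have x1 : 0 < 1 - x by lra.
rewrite /phi -powR12_sqrt; last by rewrite mulr_ge0 // ltW.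
rewrite -powRrM powRM ?ltW // /wgt !powRD; [|by apply/implyP => _; rewrite gt_eqF..].
by rewrite (mulrC 2^-1 p); ring.
Qed.

Lemma wgt_gt0 a b x : 0 < x < 1 -> 0 < wgt a b x.
Proof. by move=> hx; rewrite mulr_gt0 // powR_gt0; lra. Qed.

Lemma inv_wgt a b M k t (A : R) : 0 <= a -> 0 <= b -> 0 < t < 1 -> 0 < A ->
  k.+1%:R / M.+1%:R <= A * t -> (M - k).+1%:R / M.+1%:R <= A * (1 - t) ->
  (wgt a b t)^-1 <= A `^ a * A `^ b * node_wgt a b M k.
Proof.
move=> a0 b0 ht A0 h1 h2.
have t0 : 0 < t by lra. have t1 : 0 < 1 - t by lra.
have P (u v e : R) : 0 <= e -> 0 < u -> 0 < v -> v <= A * u -> (u `^ e)^-1 <= A `^ e * v^-1 `^ e.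
  move=> e0 u0 v0 vu.
  have v0' : 0 < v^-1 by rewrite invr_gt0.
  have H : 1 <= (A * u * v^-1) `^ e.
    have -> : 1 = 1 `^ e :> R by rewrite powR1.
    by apply: ge0_ler_powR; rewrite ?nnegrE ?mulr_ge0 ?(ltW A0) ?(ltW u0) ?(ltW v0') ?ler_pdivlMr ?mul1r.
  rewrite -[leLHS]mul1r ler_pdivrMr ?powR_gt0 //; apply: le_trans H _.
  have [A1 u1 w1] := And3 (ltW A0) (ltW u0) (ltW v0').
  by rewrite !powRM ?mulr_ge0 //; rewrite le_eqVlt; apply/orP; left; apply/eqP; ring.
have M0 : 0 < M.+1%:R :> R by rewrite ltr0n.
have H1 := P t _ a a0 t0 (divr_gt0 (ltr0Sn R k) M0) h1.
have H2 := P (1 - t) _ b b0 t1 (divr_gt0 (ltr0Sn R (M - k)) M0) h2.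
rewrite /wgt invfM /node_wgt.
rewrite !invf_div in H1 H2.
have := ler_pM _ _ H1 H2; rewrite !invr_ge0 !powR_ge0 => /(_ isT isT) H.
by apply: le_trans H _; rewrite le_eqVlt; apply/orP; left; apply/eqP; ring.
Qed.

Definition spread r : R := r.+1%:R * (r%:R + 4).

Lemma node_inv a b r n M q k t : 0 <= a -> 0 <= b -> (0 < n)%N -> (n <= M + q)%N ->
  (q <= r)%N -> (k <= M)%N -> 1 / n%:R <= t <= 1 - 1 / n%:R ->
  k%:R / (M + q)%:R - r.+2%:R / n%:R <= t <= (k + q)%:R / (M + q)%:R + r.+2%:R / n%:R ->
  (wgt a b t)^-1 <= spread r `^ a * spread r `^ b * node_wgt a b M k.
Proof.
move=> a0 b0 n0 nm qr kM ht hk.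
have n0' : 0 < n%:R :> R by rewrite ltr0n.
have m0 : 0 < (M + q)%:R :> R by rewrite ltr0n; lia.
have M0 : 0 < M.+1%:R :> R by rewrite ltr0n.
have i0 : 0 < 1 / n%:R :> R by rewrite divr_gt0.
have im : 1 / (M + q)%:R <= 1 / n%:R :> R by rewrite ler_pM2l // lef_pV2 ?posrE // ler_nat.
have rE : r.+2%:R / n%:R = (r%:R + 2) * (1 / n%:R) :> R by rewrite -addn2 natrD mulrA mulr1.
have r0 : 0 <= r%:R :> R by rewrite ler0n.
have mM : (M + q)%:R <= r.+1%:R * M.+1%:R :> R by rewrite -natrM ler_nat; nia.
have key (u v : R) : 0 <= u -> u / (M + q)%:R <= (r%:R + 4) * v -> u / M.+1%:R <= spread r * v.
  move=> u0 H; apply: (@le_trans _ _ (r.+1%:R * (u / (M + q)%:R))).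
    rewrite ler_pdivrMr //.
    have -> : r.+1%:R * (u / (M + q)%:R) * M.+1%:R = u * ((r.+1%:R * M.+1%:R) / (M + q)%:R) by ring.
    by rewrite ler_peMr // ler_pdivlMr // mul1r.
  by rewrite /spread -mulrA ler_wpM2l // ler0n.
have s0 : 0 < spread r by rewrite mulr_gt0 ?ltr0n //; lra.
have rt (v : R) : 1 / n%:R <= v -> (r%:R + 3) * (1 / n%:R) <= (r%:R + 3) * v.
  by move=> h; rewrite ler_wpM2l //; lra.
apply: inv_wgt => //; first by lra.
- apply: key; first exact: ler0n.
  have -> : k.+1%:R / (M + q)%:R = k%:R / (M + q)%:R + 1 / (M + q)%:R :> R by rewrite -natr1 mulrDl.
  by have := rt t ltac:(lra); rewrite rE in hk; lra.
- apply: key; first exact: ler0n.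
  have -> : (M - k).+1%:R / (M + q)%:R = 1 - (k + q)%:R / (M + q)%:R + 1 / (M + q)%:R :> R.
    by rewrite -natr1 natrB // !natrD; field; rewrite -natrD gt_eqF.
  by have := rt (1 - t) ltac:(lra); rewrite rE in hk; lra.
Qed.

Lemma powR_le1 (u e : R) : 0 <= u <= 1 -> 0 <= e -> u `^ e <= 1.
Proof.
move=> hu e0; have -> : 1 = 1 `^ e :> R by rewrite powR1.
by apply: ge0_ler_powR; rewrite ?nnegrE //; lra.
Qed.

Lemma wnorm_ub al be f x : 0 < al -> 0 < be -> in_Cw al be f -> 0 < x < 1 ->
  `|wgt al be x * f x| <= wnorm al be f.
Proof.
move=> al0 be0 [fc [f0 f1]] hx; apply: ub_le_sup; last by exists x.
have [d1 /= d10 h1] : exists2 d : R, 0 < d & forall t, 0 < t < d -> `|wgt al be t * f t| <= 1.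
  move/cvgrPdist_le : f0 => /(_ _ ltr01)[d /= d0 H]; exists d => // t /andP[t0 td].
  have := H t; rewrite /= sub0r normrN gtr0_norm // => /(_ td t0).
  by rewrite sub0r normrN.
have [d2 /= d20 h2] : exists2 d : R, 0 < d & forall t, 1 - d < t < 1 -> `|wgt al be t * f t| <= 1.
  move/cvgrPdist_le : f1 => /(_ _ ltr01)[d /= d0 H]; exists d => // t /andP[t0 td].
  have := H t; rewrite /= gtr0_norm; last lra.
  by move=> /(_ ltac:(lra) td); rewrite sub0r normrN.
pose u := Num.min (d1 / 2) (1 / 3); pose v := 1 - Num.min (d2 / 2) (1 / 3).
have u0 : 0 < u by rewrite lt_min; lra.
have v1 : v < 1 by rewrite /v ltrBlDr ltrDl lt_min; lra.
have [ud1 u3] : u <= d1 / 2 /\ u <= 1 / 3 by rewrite /u !ge_min !lexx !orbT.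
have [vd2 v3] : 1 - v <= d2 / 2 /\ 1 - v <= 1 / 3.
  by rewrite /v opprB addrC subrK !ge_min !lexx !orbT.
have cf : {within [set` `[u, v]], continuous f}.
  apply: continuous_in_subspaceT => t /[1!inE]/= /[!in_itv]/= ht; apply: fc; lra.
have uv : u <= v by lra.
have [c1 _ H1] := EVT_max uv cf; have [c2 _ H2] := EVT_min uv cf.
clearbody u v.
exists (1 + `|f c1| + `|f c2|) => _ [t /= ht <-].
have n1 := normr_ge0 (f c1); have n2 := normr_ge0 (f c2).
have [tu|tu] := ltP t u; first by have := h1 t ltac:(lra); lra.
have [tv|tv] := ltP v t; first by have := h2 t ltac:(lra); lra.
have tI : t \in `[u, v] by rewrite in_itv /= tu tv.
rewrite normrM (ger0_norm (wgt_ge0 _ _ _)).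
apply: (@le_trans _ _ `|f t|).
  rewrite ler_piMl // /wgt mulr_ile1 ?powR_ge0 //.
    by apply: powR_le1; lra.
  by apply: powR_le1; lra.
have A1 := H1 t tI; have A2 := H2 t tI.
have := ler_norm (f c1); have := ler_norm (- f c2); rewrite normrN ler_norml; lra.
Qed.

Lemma wnorm_r_real al be lam r f : (wnorm_r al be lam r f < +oo)%E ->
  exists D : R, [/\ wnorm_r al be lam r f = D%:E, 0 <= D &
   {ae @lebesgue_measure R, forall x, 0 < x < 1 ->
      wgt al be x * phi x `^ (r%:R * lam) * `|derive1n r f x| <= D}].
Proof.
move=> fin.
pose h (x : R) := (if 0 < x < 1 then
        (`|wgt al be x * phi x `^ (r%:R * lam) * derive1n r f x|)%:E else 0%E).
have h0 : (0 <= wnorm_r al be lam r f)%E.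
  apply: ess_sup_gee.
    have P : (0 < outer [set: R])%E.
      apply: (@lt_le_trans _ _ (outer [set` `]0, 1[%R])); last exact: outer_le.
      by rewrite outer_oo ?ler01 // subr0 lte_fin ltr01.
    exact: P.
  by apply: nearW => x; case: ifP => _; rewrite ?lee_fin.
move: fin h0 (@ess_sup_ge _ _ R (@lebesgue_measure R) h).
rewrite -/(wnorm_r al be lam r f); case: (wnorm_r _ _ _ _ _) => [D||] //= _ D0 H.
exists D; split => //.
apply: (@filterS _ _ (ae_filter_ringOfSetsType _) _ _ _ H) => x Hx hx.
move: Hx; rewrite /h hx lee_fin normrM ger0_norm // mulr_ge0 ?powR_ge0 //.
exact: wgt_ge0.
Qed.

End Weights.

Section BernsteinParts.
Variable R : realType.
Implicit Types (a b al be x t lam : R) (f psi : R -> R) (m k r n q M j : nat).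

Definition fnode psi f n r m k : R := Fn psi f n r (k%:R / m%:R).

Lemma node_itv n m k : (0 < n)%N -> (n <= m)%N -> (k <= m)%N -> 0 <= (k%:R / m%:R : R) <= 1.
Proof.
move=> n0 nm km; have m0 : 0 < m%:R :> R by rewrite ltr0n; lia.
by rewrite divr_ge0 ?ler0n //= ler_pdivrMr // mul1r ler_nat.
Qed.

Lemma le_node m j k : (j <= k)%N -> (j%:R / m%:R : R) <= k%:R / m%:R.
Proof. by move=> jk; rewrite ler_wpM2r ?invr_ge0 ?ler0n // ler_nat. Qed.

Section Node.
Variables (r n M q : nat) (psi : R -> R).
Hypotheses (r2 : (2 <= r)%N) (rn : (r < n)%N) (n4 : (4 <= n)%N) (qr : (q <= r)%N)
  (nM : (n <= M + q)%N) (hpsi : forall t, 0 <= psi t <= 1).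

Let n0 : (0 < n)%N. Proof. exact: leq_trans n4. Qed.

Lemma inner_itv t : 1 / n%:R <= t <= 1 - 1 / n%:R -> 0 < t < 1.
Proof.
have : 0 < 1 / n%:R :> R by rewrite divr_gt0 // ltr0n.
by move=> h ht; lra.
Qed.

Lemma fnode_bound al be f k j : 0 < al -> 0 < be -> in_Cw al be f -> (k <= M)%N ->
  (k <= j <= k + q)%N ->
  `|fnode psi f n r (M + q) j| <=
     lag_const R r * (spread R r `^ al * spread R r `^ be) * wnorm al be f * node_wgt al be M k.
Proof.
move=> al0 be0 fC kM /andP[kj jk].
have jm : (j <= M + q)%N by lia.
have := @Fn_near R r n psi f 0 (j%:R / (M + q)%:R)
  (spread R r `^ al * spread R r `^ be * node_wgt al be M k * wnorm al be f) r2 rn n4 hpsi.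
rewrite size_poly0 horner0 subr0 => /(_ isT (node_itv n0 nM jm)) H.
apply: (@le_trans _ _ (lag_const R r * (spread R r `^ al * spread R r `^ be * node_wgt al be M k * wnorm al be f))); last first.
  by rewrite le_eqVlt; apply/orP; left; apply/eqP; ring.
apply: H => t ht htj.
have ht1 := inner_itv ht; have w0 := wgt_gt0 al be ht1.
rewrite horner0 subr0.
have hw := wnorm_ub al0 be0 fC ht1.
have hn : (wgt al be t)^-1 <= spread R r `^ al * spread R r `^ be * node_wgt al be M k.
  apply: (@node_inv R al be r n M q k t) => //; try exact: ltW.
  have h1 := le_node (M + q) kj; have h2 := le_node (M + q) jk.
  by move: htj; rewrite ler_norml; lra.
have wn0 : 0 <= wnorm al be f by apply: le_trans hw.
apply: (@le_trans _ _ ((wgt al be t)^-1 * wnorm al be f)); last by rewrite ler_wpM2r.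
by rewrite ler_pdivlMl // -(gtr0_norm w0) -normrM.
Qed.

End Node.

Lemma lag_const_ge0 r : 0 <= lag_const R r.
Proof. by rewrite /lag_const addr_ge0 // mulr_ge0 ?exprn_ge0 ?ler0n. Qed.

Lemma node_wgt_ge0 a b M k : 0 <= node_wgt a b M k.
Proof. by rewrite mulr_ge0 ?powR_ge0. Qed.

Lemma wnorm_ge0 al be f : 0 < al -> 0 < be -> in_Cw al be f -> 0 <= wnorm al be f.
Proof.
move=> al0 be0 fC; apply: le_trans (wnorm_ub al0 be0 fC (x := 1 / 2) _); last lra.
exact: normr_ge0.
Qed.

Lemma end_bound al be r : 0 < al -> 0 < be -> (2 <= r)%N -> exists2 C : R, 0 < C &
  forall n m psi f x, (r < n)%N -> (4 <= n)%N -> (n <= m)%N -> (forall t, 0 <= psi t <= 1) ->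
  in_Cw al be f -> 0 < x < 1 ->
  wgt al be x * `|(bernp m (fnode psi f n r m))^`(r).[x]| <= C * wnorm al be f * m%:R ^+ r.
Proof.
move=> al0 be0 r2; have [C C0 HC] := @derivn_bernp_end R al be r (ltW al0) (ltW be0).
pose L := 2 ^+ r * (lag_const R r * (spread R r `^ al * spread R r `^ be)).
have L0 : 0 <= L by rewrite !mulr_ge0 ?powR_ge0 ?lag_const_ge0 ?exprn_ge0.
exists (C * (L + 1)); first by rewrite mulr_gt0 //; lra.
move=> n m psi f x rn n4 nm hpsi fC hx.
have wn0 := wnorm_ge0 al0 be0 fC.
have mE : (m = (m - r) + r)%N by lia.
rewrite mE; move: (m - r)%N mE => M mE.
have nM : (n <= M + r)%N by rewrite -mE.
apply: (@le_trans _ _ (C * (L * wnorm al be f) * (M + r)%:R ^+ r)); last first.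
  by rewrite ler_wpM2r ?exprn_ge0 ?ler0n // -mulrA ler_wpM2l ?(ltW C0) // ler_wpM2r // lerDl.
apply: HC; [lra|exact: mulr_ge0|] => k kM.
apply: le_trans (difn_bound (E := lag_const R r * (spread R r `^ al * spread R r `^ be) * wnorm al be f * node_wgt al be M k) _) _.
  by move=> j hj; apply: fnode_bound.
by rewrite le_eqVlt; apply/orP; left; apply/eqP; rewrite /L; ring.
Qed.

Lemma mid_bound al be r : 0 < al -> 0 < be -> (2 <= r)%N -> exists2 C : R, 0 < C &
  forall n m psi f x s, (r < n)%N -> (4 <= n)%N -> (n <= m)%N -> (forall t, 0 <= psi t <= 1) ->
  in_Cw al be f -> 0 < x < 1 -> s ^+ 2 = m%:R * (x * (1 - x)) -> 1 <= s ->
  wgt al be x * ((x * (1 - x)) ^+ r * `|(bernp m (fnode psi f n r m))^`(r).[x]|)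
    <= C * wnorm al be f * s ^+ r.
Proof.
move=> al0 be0 r2; have [C C0 HC] := @derivn_bernp_mid R al be r (ltW al0) (ltW be0).
pose L := lag_const R r * (spread R r `^ al * spread R r `^ be).
have L0 : 0 <= L by rewrite !mulr_ge0 ?powR_ge0 ?lag_const_ge0.
exists (C * (L + 1)); first by rewrite mulr_gt0 //; lra.
move=> n m psi f x s rn n4 nm hpsi fC hx s2 s1.
have wn0 := wnorm_ge0 al0 be0 fC.
have sr : 0 <= s ^+ r by rewrite exprn_ge0 //; lra.
apply: (@le_trans _ _ (C * (L * wnorm al be f) * s ^+ r)); last first.
  by rewrite ler_wpM2r // -mulrA ler_wpM2l ?(ltW C0) // ler_wpM2r // lerDl.
apply: HC => //; [exact: mulr_ge0|] => k km.
have nm0 : (n <= m + 0)%N by rewrite addn0.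
have := @fnode_bound r n m 0 psi r2 rn n4 (leq0n r) nm0 hpsi al be f k k al0 be0 fC km.
by rewrite !addn0 leqnn => /(_ isT).
Qed.

Lemma smooth_node r n M psi (a b D : R) f k : (2 <= r)%N -> (r < n)%N -> (4 <= n)%N ->
  (n <= M + r)%N -> (forall t, 0 <= psi t <= 1) -> 0 <= a -> 0 <= b -> 0 <= D ->
  (forall j x, (j < r.-1)%N -> 0 < x < 1 -> derivable (derive1n j f) x 1) ->
  abs_cont_oo01 (derive1n r.-1 f) ->
  {ae @lebesgue_measure R, forall x, 0 < x < 1 -> wgt a b x * `|derive1n r f x| <= D} ->
  (k <= M)%N ->
  `|difn r (fnode psi f n r (M + r)) k| <=
    2 ^+ r * (lag_const R r * (spread R r `^ a * spread R r `^ b) * (3 * r%:R + 4) ^+ r * D / n%:R ^+ r) * node_wgt a b M k.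
Proof.
move=> r2 rn n4 nM hpsi a0 b0 D0 fd fac fD kM.
have n0 : 0 < n%:R :> R by rewrite ltr0n; lia.
have m0 : 0 < (M + r)%:R :> R by rewrite ltr0n; lia.
have n4' : 4 <= n%:R :> R by rewrite ler_nat.
have i0 : 0 < 1 / n%:R :> R by rewrite divr_gt0.
have i4 : 1 / n%:R <= 1 / 4 :> R by rewrite ler_pM2l // lef_pV2 ?posrE.
have im : 1 / (M + r)%:R <= 1 / n%:R :> R by rewrite ler_pM2l // lef_pV2 ?posrE // ler_nat.
have r0 : 2 <= r%:R :> R by rewrite ler_nat.
have rE : r.+2%:R / n%:R = (r%:R + 2) * (1 / n%:R) :> R by rewrite -addn2 natrD mulrA mulr1.
have ri : 2 * (1 / n%:R) <= r%:R * (1 / n%:R) :> R by rewrite ler_pM2r.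
have kr : (k + r)%:R / (M + r)%:R = k%:R / (M + r)%:R + r%:R * (1 / (M + r)%:R) :> R.
  by rewrite natrD mulrDl mulrA mulr1.
have k01 := node_itv (leq_trans (isT : (0 < 4)%N) n4) nM (leq_trans kM (leq_addr r M)).
have k1r := node_itv (leq_trans (isT : (0 < 4)%N) n4) nM (leq_add kM (leqnn r)).
have rm : r%:R * (1 / (M + r)%:R) <= r%:R * (1 / n%:R) :> R by rewrite ler_pM2l //; lra.
pose lo := Num.max (1 / n%:R) (k%:R / (M + r)%:R - r.+2%:R / n%:R) : R.
pose hi := Num.min (1 - 1 / n%:R) ((k + r)%:R / (M + r)%:R + r.+2%:R / n%:R) : R.
have lohi : lo <= hi.
  have hk := le_node (M + r) (leq_addr r k).
  by rewrite /lo /hi ge_max !le_min; apply/andP; split; apply/andP; split; rewrite ?rE; lra.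
have [lo1 lo2] : 1 / n%:R <= lo /\ k%:R / (M + r)%:R - r.+2%:R / n%:R <= lo.
  by rewrite /lo !le_max !lexx orbT.
have [hi1 hi2] : hi <= 1 - 1 / n%:R /\ hi <= (k + r)%:R / (M + r)%:R + r.+2%:R / n%:R.
  by rewrite /hi !ge_min !lexx orbT.
have width : hi - lo <= (3 * r%:R + 4) * (1 / n%:R) by move: lo2 hi2; rewrite rE kr; lra.
pose D1 := D * (spread R r `^ a * spread R r `^ b * node_wgt a b M k).
have D10 : 0 <= D1 by rewrite !mulr_ge0 ?powR_ge0 ?node_wgt_ge0.
have rS : r = r.-1.+1 by rewrite prednK // (leq_trans _ r2).
have n0n : (0 < n)%N by apply: leq_trans n4.
have lip u v : lo <= u -> u <= v -> v <= hi ->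
    `|derive1n r.-1 f v - derive1n r.-1 f u| <= D1 * (v - u).
  move=> lu uv vh; apply: abs_cont_lipschitz => //; first by apply: fac; lra.
  apply: (@filterS _ _ (ae_filter_ringOfSetsType _) _ _ _ fD) => x Hx hx.
  have hx1 : 0 < x < 1 by lra.
  have w0 := wgt_gt0 a b hx1.
  have -> : derive1 (derive1n r.-1 f) x = derive1n r f x by rewrite [in RHS]rS derive1nS.
  have hw : (wgt a b x)^-1 <= spread R r `^ a * spread R r `^ b * node_wgt a b M k.
    by apply: (@node_inv R a b r n M r k x) => //; lra.
  apply: (@le_trans _ _ (D * (wgt a b x)^-1)); last by rewrite ler_wpM2l.
  by rewrite ler_pdivlMr // mulrC; exact: Hx.
have [|||P [sP HP]] := @taylor_lip R r.-1 f lo hi lo D1; first by rewrite lexx.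
- by move=> j x jr hx; apply: fd => //; lra.
- move=> x y hx hy; have [xy|yx] := leP x y.
    by rewrite distrC (distrC x) (@ger0_norm _ (y - x)); [apply: lip; lra|lra].
  by rewrite (@ger0_norm _ (x - y)); [apply: lip; lra|lra].
rewrite -rS in sP HP.
pose E := D1 * ((3 * r%:R + 4) * (1 / n%:R)) ^+ r.
have near j : (k <= j <= k + r)%N ->
    `|fnode psi f n r (M + r) j - P.[j%:R * (M + r)%:R^-1]| <= lag_const R r * E.
  move=> /andP[kj jk]; apply: Fn_near => //.
    by apply: (node_itv n0n nM); exact: leq_trans jk (leq_add kM (leqnn r)).
  move=> t ht; rewrite ler_norml => htj.
  have h1 := le_node (M + r) kj; have h2 := le_node (M + r) jk.
  have tI : lo <= t <= hi.
    by rewrite /lo /hi ge_max le_min; apply/andP; split; apply/andP; split; lra.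
  have dt : `|t - lo| <= (3 * r%:R + 4) * (1 / n%:R) by rewrite ger0_norm; lra.
  by apply: le_trans (HP t tI) _; rewrite ler_wpM2l // lerXn2r ?nnegrE // (le_trans _ dt).
have -> : difn r (fnode psi f n r (M + r)) k =
    difn r (fun j => fnode psi f n r (M + r) j - P.[j%:R * (M + r)%:R^-1]) k.
  by rewrite difnB difn_poly // subr0.
apply: le_trans (difn_bound near) _.
rewrite /E /D1 exprMn expr_div_n expr1n; rewrite le_eqVlt; apply/orP; left; apply/eqP.
by field; rewrite expf_neq0 // gt_eqF.
Qed.

Lemma smooth_bound a b r : 0 <= a -> 0 <= b -> (2 <= r)%N -> exists2 C : R, 0 < C &
  forall n m psi f D x, (r < n)%N -> (4 <= n)%N -> (n <= m)%N -> (forall t, 0 <= psi t <= 1) ->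
  0 <= D ->
  (forall j x, (j < r.-1)%N -> 0 < x < 1 -> derivable (derive1n j f) x 1) ->
  abs_cont_oo01 (derive1n r.-1 f) ->
  {ae @lebesgue_measure R, forall x, 0 < x < 1 -> wgt a b x * `|derive1n r f x| <= D} ->
  0 < x < 1 ->
  wgt a b x * `|(bernp m (fnode psi f n r m))^`(r).[x]| <= C * D * (m%:R / n%:R) ^+ r.
Proof.
move=> a0 b0 r2; have [C C0 HC] := @derivn_bernp_end R a b r a0 b0.
pose L := 2 ^+ r * (lag_const R r * (spread R r `^ a * spread R r `^ b) * (3 * r%:R + 4) ^+ r).
have L0 : 0 <= L by rewrite !mulr_ge0 ?powR_ge0 ?lag_const_ge0 ?exprn_ge0 // addr_ge0 // mulr_ge0.
exists (C * (L + 1)); first by rewrite mulr_gt0 //; lra.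
move=> n m psi f D x rn n4 nm hpsi D0 fd fac fD hx.
have mE : (m = (m - r) + r)%N by lia.
rewrite mE; move: (m - r)%N mE => M mE.
have nM : (n <= M + r)%N by rewrite -mE.
have n0 : 0 < n%:R ^+ r :> R by rewrite exprn_gt0 // ltr0n; lia.
apply: (@le_trans _ _ (C * (L * D / n%:R ^+ r) * (M + r)%:R ^+ r)); last first.
  rewrite expr_div_n.
  have -> : C * (L + 1) * D * ((M + r)%:R ^+ r / n%:R ^+ r) = C * ((L + 1) * D / n%:R ^+ r) * (M + r)%:R ^+ r by ring.
  by rewrite ler_wpM2r ?exprn_ge0 ?ler0n // ler_wpM2l ?(ltW C0) // ler_pM2r ?invr_gt0 // ler_wpM2r // lerDl.
apply: HC; [lra|by apply: divr_ge0; [exact: mulr_ge0|exact: ltW]|] => k kM.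
apply: le_trans (smooth_node (a := a) (b := b) (D := D) r2 rn n4 nM hpsi a0 b0 D0 fd fac fD kM) _.
by rewrite le_eqVlt; apply/orP; left; apply/eqP; rewrite /L; ring.
Qed.

End BernsteinParts.

Section Combination.
Variable R : realType.
Implicit Types (x lam K : R) (f psi : R -> R) (r n i : nat).

Lemma sqrt_pow (N : R) r : 0 <= N -> Num.sqrt N ^+ r = N `^ (r%:R / 2).
Proof. by move=> N0; rewrite -powR12_sqrt // -powR_mulrn ?powR_ge0 // -powRrM mulrC. Qed.

Lemma end_power (N x lam : R) r : 0 < N -> 0 < x < 1 -> N * (x * (1 - x)) <= 1 -> 0 <= lam ->
  phi x `^ (r%:R * lam) * N ^+ r <= N `^ (r%:R / 2) * N `^ (r%:R * (1 - lam) / 2).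
Proof.
move=> N0 hx NX l0.
have X0 : 0 < x * (1 - x) by rewrite mulr_gt0; lra.
have p0 : 0 <= 2^-1 * (r%:R * lam) by rewrite !mulr_ge0.
have Nn : N != 0 by rewrite gt_eqF.
have -> : N ^+ r = N `^ r%:R by rewrite powR_mulrn // ltW.
rewrite /phi -powR12_sqrt ?(ltW X0) // -powRrM.
apply: (@le_trans _ _ (N `^ (- (2^-1 * (r%:R * lam))) * N `^ r%:R)).
  rewrite ler_wpM2r ?powR_ge0 //.
  have -> : N `^ (- (2^-1 * (r%:R * lam))) = (N `^ (-1)) `^ (2^-1 * (r%:R * lam)).
    by rewrite -powRrM mulN1r.
  apply: ge0_ler_powR; rewrite ?nnegrE ?powR_ge0 ?(ltW X0) //.
  by rewrite powR_inv1 ?(ltW N0) // -[leRHS]mul1r ler_pdivlMr // mulrC.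
rewrite -!powRD; [|by rewrite Nn implybT..].
by rewrite le_eqVlt; apply/orP; left; apply/eqP; congr (_ `^ _); field.
Qed.

Lemma phi_powB x lam r : 0 < x < 1 ->
  phi x `^ (r%:R * lam) = phi x `^ (r%:R * (lam - 1)) * phi x ^+ r.
Proof.
move=> hx; have p0 := phi_gt0 hx.
rewrite -powR_mulrn ?(ltW p0) // -powRD; last by apply/implyP => _; rewrite gt_eqF.
by congr (_ `^ _); ring.
Qed.

Lemma comb_nodes K r nn (cc : nat -> nat -> R) n i : (2 <= r)%N -> comb_family K r nn cc n ->
  (i < r.-1)%N -> (n <= nn n i)%N /\ (nn n i)%:R <= K * n%:R.
Proof.
move=> r2 [[nn0 [nnS nnK]] _ _ _] ir.
have lo j : (j < r.-1)%N -> (n <= nn n j)%N.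
  elim: j => [|j IH] jr; first by rewrite nn0.
  exact: leq_trans (IH (ltnW jr)) (ltnW (nnS j jr)).
have hi j : (i + j < r.-1)%N -> (nn n i <= nn n (i + j))%N.
  elim: j => [|j IH] jr; first by rewrite addn0.
  rewrite addnS in jr *; exact: leq_trans (IH (ltnW jr)) (ltnW (nnS _ jr)).
split; first exact: lo.
apply: le_trans nnK; rewrite ler_nat.
have -> : (r - 2 = i + (r - 2 - i))%N by lia.
by apply: hi; lia.
Qed.

Lemma derive1n_Bstar psi nn (cc : nat -> nat -> R) n r f x :
  derive1n r (Bstar psi nn cc n r f) x =
  \sum_(i < r.-1) cc n i * (bernp (nn n i) (fnode psi f n r (nn n i)))^`(r).[x].
Proof.
have -> : Bstar psi nn cc n r f =
    horner (\sum_(i < r.-1) cc n i *: bernp (nn n i) (fnode psi f n r (nn n i))).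
  apply/funext => y; rewrite /Bstar horner_sum; apply: eq_bigr => i _.
  by rewrite hornerZ BernE.
rewrite derive1n_horner linear_sum horner_sum; apply: eq_bigr => i _ /=.
by rewrite derivnZ hornerZ.
Qed.

Lemma comb_le (c b : nat -> R) m (w B K : R) : 0 <= w -> 0 <= B ->
  \sum_(i < m) `|c i| <= K -> (forall i, (i < m)%N -> w * `|b i| <= B) ->
  w * `|\sum_(i < m) c i * b i| <= K * B.
Proof.
move=> w0 B0 cK H; apply: (@le_trans _ _ (\sum_(i < m) `|c i| * B)).
  apply: (@le_trans _ _ (w * \sum_(i < m) `|c i * b i|)).
    by rewrite ler_wpM2l // ler_norm_sum.
  rewrite mulr_sumr; apply: ler_sum => i _.
  by rewrite normrM mulrCA ler_wpM2l // H.
by rewrite -mulr_suml ler_wpM2r.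
Qed.

End Combination.

Unset Implicit Arguments.
Theorem theorem2 (R : realType) (r : nat) (hr : (2 <= r)%N)
  (al be lam : R) (hal : 0 < al) (hbe : 0 < be) (hlam : 0 <= lam <= 1)
  (psi : R -> R) (hpsi : cutoff psi)
  (K : R) (nn : nat -> nat -> nat) (cc : nat -> nat -> R)
  (hfam : forall n : nat, (4 <= n)%N -> (r < n)%N -> comb_family K r nn cc n) :
  exists C : R, 0 < C /\
    forall n : nat, (4 <= n)%N -> (r < n)%N ->
      (forall (f : R -> R) (x : R), in_Cw al be f -> 0 < x < 1 ->
         `|wgt al be x * phi x `^ (r%:R * lam)
             * derive1n r (Bstar psi nn cc n r f) x|
         <= C * n%:R `^ (r%:R / 2)
              * Num.max (n%:R `^ (r%:R * (1 - lam) / 2)) (phi x `^ (r%:R * (lam - 1)))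
              * wnorm al be f) /\
      (forall (f : R -> R) (x : R), in_W al be lam r f -> 0 < x < 1 ->
         ((`|wgt al be x * phi x `^ (r%:R * lam)
             * derive1n r (Bstar psi nn cc n r f) x|)%:E
         <= C%:E * wnorm_r al be lam r f)%E).
Proof.
have [_ [psi01 _]] := hpsi.
have rl0 : 0 <= r%:R * lam / 2 by rewrite !mulr_ge0 //; lra.
have [C1 C10 H1] := end_bound hal hbe hr.
have [C2 C20 H2] := mid_bound hal hbe hr.
have [C3 C30 H3] := @smooth_bound R (al + r%:R * lam / 2) (be + r%:R * lam / 2) r
  (addr_ge0 (ltW hal) rl0) (addr_ge0 (ltW hbe) rl0) hr.
pose K1 := `|K| + 1.
have K11 : 1 <= K1 by rewrite /K1 lerDr.
have KK1 : K <= K1 by rewrite /K1; have := ler_norm K; lra.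
have K10 : 0 < K1 by lra.
have Kr : 0 < K1 ^+ r by rewrite exprn_gt0.
exists (K1 * ((C1 + C2 + C3) * K1 ^+ r)); split; first by rewrite !mulr_gt0 // !addr_gt0.
move=> n n4 rn; have fam := hfam n n4 rn.
have [_ ccK _ _] := fam.
have N0 : 0 < n%:R :> R by rewrite ltr0n; apply: leq_trans n4.
have nodes (i : nat) : (i < r.-1)%N -> (n <= nn n i)%N /\ (nn n i)%:R <= K1 * n%:R.
  move=> ir; have [h1 h2] := comb_nodes hr fam ir; split => //.
  by apply: le_trans h2 _; rewrite ler_wpM2r // ltW.
have ccK1 : \sum_(i < r.-1) `|cc n i| <= K1 by apply: le_trans KK1.
split => f x hf hx.
- have wn0 := wnorm_ge0 hal hbe hf.
  have X0 : 0 < x * (1 - x) by rewrite mulr_gt0; lra.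
  have W0 : 0 <= wgt al be x * phi x `^ (r%:R * lam) by rewrite mulr_ge0 ?wgt_ge0 ?powR_ge0.
  have w0 := wgt_gt0 al be hx; have p0 := phi_gt0 hx.
  set mx := Num.max _ _.
  have mx0 : 0 <= mx by rewrite /mx le_max powR_ge0.
  rewrite derive1n_Bstar normrM (ger0_norm W0).
  have -> : K1 * ((C1 + C2 + C3) * K1 ^+ r) * n%:R `^ (r%:R / 2) * mx * wnorm al be f =
     K1 * ((C1 + C2 + C3) * (K1 ^+ r * (n%:R `^ (r%:R / 2) * mx) * wnorm al be f)) by ring.
  have Z0 : 0 <= K1 ^+ r * (n%:R `^ (r%:R / 2) * mx) * wnorm al be f.
    by rewrite !mulr_ge0 ?powR_ge0 ?(ltW Kr).
  set Z := K1 ^+ r * _ * _ in Z0 *.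
  apply: (@comb_le R (cc n) (fun i => (bernp (nn n i) (fnode psi f n r (nn n i)))^`(r).[x])) => //.
    by rewrite mulr_ge0 // !addr_ge0 // ltW.
  move=> i ir; have [nm mK] := nodes i ir.
  set B := `|_|.
  have B0 : 0 <= B by exact: normr_ge0.
  have [NX|NX] := leP (n%:R * (x * (1 - x))) 1.
  + have hB : wgt al be x * B <= C1 * wnorm al be f * (nn n i)%:R ^+ r by exact: H1.
    have hm : (nn n i)%:R ^+ r <= K1 ^+ r * n%:R ^+ r.
      by rewrite -exprMn lerXn2r // nnegrE ?ler0n // mulr_ge0 // ltW.
    have hp := end_power r N0 hx NX (proj1 (andP hlam)).
    have hmx : n%:R `^ (r%:R / 2) * n%:R `^ (r%:R * (1 - lam) / 2) <= n%:R `^ (r%:R / 2) * mx.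
      by rewrite ler_wpM2l ?powR_ge0 // /mx le_max lexx.
    apply: (@le_trans _ _ (phi x `^ (r%:R * lam) * (C1 * wnorm al be f * (K1 ^+ r * n%:R ^+ r)))).
      rewrite mulrAC mulrC ler_wpM2l ?powR_ge0 //; apply: le_trans hB _.
      by rewrite ler_wpM2l // mulr_ge0 // ltW.
    have -> : phi x `^ (r%:R * lam) * (C1 * wnorm al be f * (K1 ^+ r * n%:R ^+ r)) =
       C1 * (K1 ^+ r * (phi x `^ (r%:R * lam) * n%:R ^+ r) * wnorm al be f) by ring.
    apply: (@le_trans _ _ (C1 * Z)); last by rewrite ler_wpM2r //; lra.
    rewrite ler_wpM2l ?(ltW C10) // /Z ler_wpM2r // ler_wpM2l ?(ltW Kr) //.
    exact: le_trans hp hmx.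
  + pose s := Num.sqrt (nn n i)%:R * phi x.
    have m0 : 0 <= (nn n i)%:R :> R by exact: ler0n.
    have s2 : s ^+ 2 = (nn n i)%:R * (x * (1 - x)) by rewrite /s exprMn sqr_sqrtr // phi_sqr.
    have s0 : 0 <= s by rewrite /s mulr_ge0 ?sqrtr_ge0 // ltW.
    have s1 : 1 <= s.
      rewrite -(@ler_pXn2r _ 2) ?nnegrE // expr1n s2; apply: le_trans (ltW NX) _.
      by rewrite ler_pM2r // ler_nat.
    have hB := H2 n (nn n i) psi f x s rn n4 nm psi01 hf hx s2 s1; rewrite -/B in hB.
    have hs : s <= K1 * Num.sqrt n%:R * phi x.
      rewrite /s ler_wpM2r ?(ltW p0) //.
      rewrite -(@ler_pXn2r _ 2) ?nnegrE ?sqrtr_ge0 //; last by rewrite mulr_ge0 ?sqrtr_ge0 // ltW.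
      rewrite exprMn !sqr_sqrtr ?(ltW N0) //; apply: le_trans mK _.
      by rewrite ler_wpM2r ?(ltW N0) // expr2 ler_peMl // ltW.
    have hsr : s ^+ r <= K1 ^+ r * n%:R `^ (r%:R / 2) * phi x ^+ r.
      rewrite -sqrt_pow ?(ltW N0) // -!exprMn lerXn2r // nnegrE.
      by rewrite !mulr_ge0 ?sqrtr_ge0 // ltW.
    have pr : 0 < phi x ^+ r by rewrite exprn_gt0.
    have hB' : wgt al be x * (phi x ^+ r * B) <= C2 * wnorm al be f * (K1 ^+ r * n%:R `^ (r%:R / 2)).
      rewrite -(ler_pM2r pr).
      have -> : wgt al be x * (phi x ^+ r * B) * phi x ^+ r = wgt al be x * ((x * (1 - x)) ^+ r * B).
        by rewrite -phi_sqr // exprAC expr2; ring.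
      have cw0 : 0 <= C2 * wnorm al be f by rewrite mulr_ge0 // ltW.
      by apply: le_trans hB _; rewrite -[leRHS]mulrA ler_wpM2l.
    rewrite phi_powB //.
    have -> : wgt al be x * (phi x `^ (r%:R * (lam - 1)) * phi x ^+ r) * B =
      phi x `^ (r%:R * (lam - 1)) * (wgt al be x * (phi x ^+ r * B)) by ring.
    apply: (@le_trans _ _ (mx * (C2 * wnorm al be f * (K1 ^+ r * n%:R `^ (r%:R / 2))))).
      apply: ler_pM => //; rewrite ?powR_ge0 //.
        by apply: mulr_ge0; [exact: ltW|apply: mulr_ge0; [exact: ltW|]].
      by rewrite /mx le_max lexx orbT.
    have -> : mx * (C2 * wnorm al be f * (K1 ^+ r * n%:R `^ (r%:R / 2))) = C2 * Z by rewrite /Z; ring.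
    by rewrite ler_wpM2r //; lra.
- have [fC [fd [fac ffin]]] := hf.
  have [D [-> D0 HD]] := wnorm_r_real ffin.
  rewrite -EFinM lee_fin derive1n_Bstar wgt_phi // normrM (ger0_norm (wgt_ge0 _ _ _)).
  have HD' : {ae @lebesgue_measure R, forall x, 0 < x < 1 ->
      wgt (al + r%:R * lam / 2) (be + r%:R * lam / 2) x * `|derive1n r f x| <= D}.
    apply: (@filterS _ _ (ae_filter_ringOfSetsType _) _ _ _ HD) => y Hy hy.
    by rewrite -wgt_phi //; exact: Hy.
  rewrite -[leRHS]mulrA.
  apply: (@comb_le R (cc n) (fun i => (bernp (nn n i) (fnode psi f n r (nn n i)))^`(r).[x])) => //.
  + exact: wgt_ge0.
  + by rewrite !mulr_ge0 ?(ltW Kr) // !addr_ge0 // ltW.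
  + move=> i ir; have [nm mK] := nodes i ir.
    have hB := H3 n (nn n i) psi f D x rn n4 nm psi01 D0 (fun j y jr => fd j jr y) fac HD' hx.
    apply: le_trans hB _.
    have mr : ((nn n i)%:R / n%:R) ^+ r <= K1 ^+ r.
      by rewrite lerXn2r // ?nnegrE ?divr_ge0 ?ler0n ?(ltW K10) // ler_pdivrMr.
    apply: (@le_trans _ _ (C3 * D * K1 ^+ r)); first by rewrite ler_wpM2l // mulr_ge0 // ltW.
    rewrite mulrAC ler_wpM2r // ler_wpM2r ?(ltW Kr) //; lra.
Qed.
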